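(* Let $n$ be a positive integer and $\epsilon\in(0,1)$. There exists a subset $S\subseteq[n]\times[n]$ of $s = O\!\left(\frac{n\log^4(1/\epsilon)}{\epsilon^4}\right)$ entries such that, letting $\mathbf S\in\mathbb{R}^{n\times n}$ have $\mathbf S_{ij}=\frac{n^2}{s}$ for $(i,j)\in S$ and $\mathbf S_{ij}=0$ otherwise, simultaneously for all symmetric matrices $\mathbf A\in\mathbb{R}^{n\times n}$ with bounded entries, $$\|\mathbf A - \mathbf A\circ\mathbf S\|_2 \le \epsilon\cdot\max(n,\|\mathbf A\|_1).$$
   Context: A matrix $\mathbf A$ has bounded entries if $\max_{i,j}|\mathbf A_{ij}|\le 1$. $\circ$ is the entrywise product, $\|\cdot\|_2$ the spectral norm, and $\|\mathbf A\|_1=\sum_i\sigma_i(\mathbf A)$ the nuclear (Schatten-1) norm.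
   Formalization: The factor log(1/ε) in the bound on s is read as max(1, ln(1/ε)), with one absolute constant for all n and all ε in (0,1); with the bare logarithm the bound would force S to be empty as ε tends to 1, and the claim fails for the all-ones matrix. *)

(* Defs.v *)
From mathcomp Require Import all_boot all_order all_algebra.
From mathcomp Require Import all_classical all_reals all_analysis.
From mathcomp Require Import polyrcf.

Set Implicit Arguments.
Unset Strict Implicit.
Unset Printing Implicit Defensive.

Import Order.TTheory GRing.Theory Num.Theory.

Local Open Scope classical_set_scope.
Local Open Scope ring_scope.

Definition l2norm (R : realType) (n : nat) (x : 'cV[R]_n) : R :=
  Num.sqrt (\sum_i x i 0 ^+ 2).

Definition spectral_norm (R : realType) (m n : nat) (A : 'M[R]_(m, n)) : R :=
  sup [set l2norm (A *m x) | x in [set x : 'cV[R]_n | l2norm x <= 1]].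

(* The square roots of the eigenvalues of A^T A, each listed with its algebraic
   multiplicity: [rootsR p] is the sequence of the distinct roots of p in R, and
   char_poly (A^T *m A) splits over R because A^T A is symmetric.  There are n
   values for A : 'M_(m, n); when m < n the additional ones are zero. *)
Definition singular_values (R : realType) (m n : nat) (A : 'M[R]_(m, n)) :
    seq R :=
  let p := char_poly (A^T *m A) in
  flatten [seq nseq (mup l p) (Num.sqrt l) | l <- rootsR p].

Definition nuclear_norm (R : realType) (m n : nat) (A : 'M[R]_(m, n)) : R :=
  \sum_(s <- singular_values A) s.

Definition bounded_entries (R : realType) (m n : nat) (A : 'M[R]_(m, n)) :
    Prop :=
  forall i j, `|A i j| <= 1.

Definition hadamard (R : realType) (m n : nat) (A B : 'M[R]_(m, n)) :
    'M[R]_(m, n) :=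
  map2_mx *%R A B.

Definition sampling_matrix (R : realType) (n : nat) (S : {set 'I_n * 'I_n}) :
    'M[R]_n :=
  \matrix_(i, j) if (i, j) \in S then n%:R ^+ 2 / #|S|%:R else 0.

(* Main.v *)
Require Import Defs.
From mathcomp Require Import all_boot all_order all_algebra.
From mathcomp Require Import all_classical all_reals all_analysis.
From mathcomp Require Import spectral sesquilinear polyrcf complex.
From mathcomp Require Import ring lra zify.

Set Implicit Arguments.
Unset Strict Implicit.
Unset Printing Implicit Defensive.

Import Order.TTheory GRing.Theory Num.Theory.

Local Open Scope ring_scope.

(* Put q = |S| / n^2 and B = 1_S - q, so that A - A o S = - (A o B) / q, and
   suppose that the spectral norm of B is at most c eps^2 q n for a small
   constant c.  For unit vectors x and y, call a pair (i, j) light when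
   |x_i| |y_j| is at most about 1 / (eps n).  On the light pairs, pair A with the
   matrix (B_ij x_i y_j): a Schur test over the dyadic levels of x and y bounds
   its spectral norm by that of B divided by eps n, and duality with the nuclear
   norm gives eps q |A|_1.  On the heavy pairs use |A_ij| <= 1: the sum of
   |x_i| |y_j| over them is at most about eps n, and B has norm small enough for
   the edges of S to follow the average.

   The set S is a random subset of density d / n, d = K log^4(1/eps) / eps^4: a
   Chernoff bound weighted by the entropy of pairs of sets gives discrepancy
   O(sqrt d log d) on all pairs of sets, and the converse of the expander mixing
   lemma turns this into a spectral norm O(sqrt d log^2 d). *)

(** * Spectral decomposition and the nuclear norm *)

Lemma Re_sum (R : rcfType) (I : finType) (F : I -> R[i]) :
  complex.Re (\sum_i F i) = \sum_i complex.Re (F i).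
Proof. by apply: (big_morph (@complex.Re R)) => // -[? ?] [? ?]. Qed.

Lemma Re_mul_conj (R : rcfType) (x y : R[i]) :
  complex.Re (x^* * y) =
  complex.Re x * complex.Re y + complex.Im x * complex.Im y.
Proof. by case: x y => [a b] [c d] /=; ring. Qed.

Lemma char_poly_similar (F : fieldType) n (P D : 'M[F]_n) : P \in unitmx ->
  char_poly (invmx P *m D *m P) = char_poly D.
Proof.
move=> Pu; rewrite /char_poly.
have -> : char_poly_mx (invmx P *m D *m P) =
    map_mx polyC (invmx P) *m char_poly_mx D *m map_mx polyC P.
  rewrite /char_poly_mx mulmxBr mulmxBl -!map_mxM; congr (_ - _).
  by rewrite mul_mx_scalar -scalemxAl -map_mxM mulVmx// map_mx1 scalemx1.
rewrite !det_mulmx mulrAC -det_mulmx -map_mxM mulVmx// map_mx1 det1.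
by rewrite mul1r.
Qed.

Section SymmetricSpectral.
Local Open Scope sesquilinear_scope.

(** [G] is diagonalised by a unitary matrix over [R[i]], whose rows have real parts [a k] and
    imaginary parts [b k]. Together these [2 n] real vectors resolve the identity, so they can
    replace a real orthonormal eigenbasis in trace computations. *)
Lemma symmetric_spectral (R : rcfType) n (G : 'M[R]_n) : G^T = G ->
  exists (a b : 'M[R]_n) (r : 'I_n -> R),
  [/\ forall i j, \sum_k (a k i * a k j + b k i * b k j) = (i == j)%:R,
      forall k, \sum_i \sum_j G i j * (a k i * a k j + b k i * b k j) = r k,
      forall k, \sum_i (a k i ^+ 2 + b k i ^+ 2) = 1
    & char_poly G = \prod_k ('X - (r k)%:P)].
Proof.
move=> Gsym.
pose f := (real_complex R : {rmorphism R -> R[i]}).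
pose H := map_mx f G.
have Hherm : H \is hermsymmx.
  apply: realsym_hermsym.
    apply/is_hermitianmxP; rewrite expr0 scale1r map_mx_id//.
    by rewrite /H map_trmx Gsym.
  by apply/mxOverP => i j; rewrite mxE complex_real.
have /orthomx_spectralP HE := hermitian_normalmx Hherm.
have Dreal := hermitian_spectral_diag_real Hherm.
set P := spectralmx H in HE; set D := spectral_diag H in HE Dreal.
have Pu : P \is unitarymx by exact: spectral_unitarymx.
have PV := invmx_unitary Pu.
have DE k : D 0 k = f (complex.Re (D 0 k)).
  apply/esym/eqP; rewrite /f /=.
  have /mxOverP/(_ 0 k) := Dreal.
  by move=> /complex_realP[x ->].
have PP1 : (P ^t* ) *m P = 1%:M by rewrite -PV mulVmx// unitarymx_unit.
have PP2 : P *m (P ^t* ) = 1%:M by apply/unitarymxP.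
have PHP : P *m H *m (P ^t* ) = diag_mx D.
  by rewrite HE PV !mulmxA PP2 mul1mx -mulmxA PP2 mulmx1.
exists (map_mx (@complex.Re R) P), (map_mx (@complex.Im R) P).
exists (fun k => complex.Re (D 0 k)); split.
- move=> i j.
  have /(congr1 (@complex.Re R)) := congr1 (fun (M : 'M[R[i]]_n) => M i j) PP1.
  rewrite !mxE Re_sum => E; rewrite (_ : _%:R = complex.Re (((i == j)%:R :
    R[i]))).
    rewrite -E; apply: eq_bigr => k _; rewrite !mxE.
    by rewrite Re_mul_conj.
  by case: eqP.
- move=> k.
  have /(congr1 (@complex.Re R)) := congr1 (fun (M : 'M[R[i]]_n) => M k k) PHP.
  rewrite !mxE eqxx mulr1n Re_sum => <-.
  rewrite exchange_big /=; apply: eq_bigr => j _; rewrite !mxE mulr_suml Re_sum.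
  apply: eq_bigr => i _; rewrite !mxE;
  by case: (P k i) (P k j) => [? ?] [? ?] /=; ring.
- move=> k.
  have /(congr1 (@complex.Re R)) := congr1 (fun (M : 'M[R[i]]_n) => M k k) PP2.
  rewrite !mxE eqxx Re_sum => E; rewrite -[1]/(complex.Re (1%:R : R[i])) -E.
  by apply: eq_bigr => i _; rewrite !mxE mulrC Re_mul_conj !expr2.
(* The characteristic polynomials are compared over [R[i]], where [G] is similar to the diagonal
   matrix of its eigenvalues. *)
- apply: (@map_poly_inj _ _ f).
  rewrite map_char_poly -/H rmorph_prod.
  rewrite HE char_poly_similar ?unitarymx_unit// char_poly_trig
    ?diag_mx_is_trig//.
  by apply: eq_bigr => k _; rewrite rmorphB /= map_polyX map_polyC /= mxE eqxx
    mulr1n -DE.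
Qed.

End SymmetricSpectral.

Definition sqsum (R : rcfType) (I : finType) (x : I -> R) : R :=
  \sum_i x i ^+ 2.

Definition bilin (R : rcfType) (I J : finType) (B : I -> J -> R)
    (x : I -> R) (y : J -> R) : R :=
  \sum_i \sum_j B i j * x i * y j.

(** A spectral norm bound stated as a homogeneous inequality between bilinear forms, so that no
    supremum appears and the index types are arbitrary. *)
Definition opbound (R : rcfType) (I J : finType) (B : I -> J -> R) (c : R) :=
  forall x y, bilin B x y <= c * (Num.sqrt (sqsum x) * Num.sqrt (sqsum y)).

Section Bilinear.
Variables (R : rcfType) (I J : finType).
Implicit Types (x : I -> R) (y : J -> R) (B : I -> J -> R).

Lemma sqsum_ge0 x : 0 <= sqsum x.
Proof. by apply: sumr_ge0 => i _; exact: sqr_ge0. Qed.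

Lemma sqsum_eq0 x : sqsum x = 0 -> forall i, x i = 0.
Proof.
move=> x0 i; apply/eqP; rewrite -sqrf_eq0; apply/eqP; move: i (erefl true).
by apply: psumr_eq0P => // i _; exact: sqr_ge0.
Qed.

Lemma bilinZ B s t x y :
  bilin B (fun i => s * x i) (fun j => t * y j) = s * t * bilin B x y.
Proof.
rewrite /bilin mulr_sumr; apply: eq_bigr => i _.
by rewrite mulr_sumr; apply: eq_bigr => j _; ring.
Qed.

End Bilinear.

Lemma opbound_unit (R : rcfType) (I J : finType) (B : I -> J -> R) c :
  (forall x y, sqsum x <= 1 -> sqsum y <= 1 -> bilin B x y <= c) ->
  opbound B c.
Proof.
move=> H x y.
have unit (K : finType) (z : K -> R) : exists2 u,
    sqsum u <= 1 & forall k, z k = Num.sqrt (sqsum z) * u k.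
  have [z0|z0] := eqVneq (sqsum z) 0.
    exists (fun=> 0); first by rewrite /sqsum big1// => k _; rewrite expr0n.
    by move=> k; rewrite mulr0 (sqsum_eq0 z0).
  have s0 : Num.sqrt (sqsum z) != 0 by rewrite sqrtr_eq0 -ltNge lt_def z0
    sqsum_ge0.
  exists (fun k => (Num.sqrt (sqsum z))^-1 * z k).
    rewrite /sqsum; under eq_bigr do rewrite exprMn.
    by rewrite -mulr_sumr -/(sqsum z) exprVn sqr_sqrtr ?sqsum_ge0// mulVf.
  by move=> k; rewrite mulrA divff// mul1r.
have [[u u1 xE] [v v1 yE]] := (unit _ x, unit _ y).
rewrite (_ : bilin B x y = bilin B (fun i => Num.sqrt (sqsum x) * u i)
  (fun j => Num.sqrt (sqsum y) * v j)); last first.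
  by apply: eq_bigr => i _; apply: eq_bigr => j _; rewrite -xE -yE.
by rewrite bilinZ mulrC ler_wpM2r ?mulr_ge0 ?sqrtr_ge0// H.
Qed.

(** In a split polynomial the multiplicity of a root is its number of occurrences in the list of
    roots, so [singular_values] lists the square roots of the [r k] up to order. *)
Lemma nuclear_normE (R : realType) n (A : 'M[R]_n) (r : 'I_n -> R) :
  char_poly (A^T *m A) = \prod_k ('X - (r k)%:P) ->
  nuclear_norm A = \sum_k Num.sqrt (r k).
Proof.
move=> pE; rewrite /nuclear_norm /singular_values.
set p := char_poly _ in pE *.
pose rs := [seq r k | k <- index_enum 'I_n].
have pE' : p = \prod_(y <- rs) ('X - y%:P) by rewrite pE big_map.
have p0 : p != 0 by exact/monic_neq0/char_poly_monic.
rewrite big_flatten big_map -[RHS](big_map r xpredT Num.sqrt) -/rs.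
rewrite -[RHS]big_undup_iterop_count /=.
have pm : perm_eq (rootsR p) (undup rs).
  apply: uniq_perm; first 2 [exact: undup_uniq].
    by have /sorted_uniq := sorted_roots (- cauchy_bound p) (cauchy_bound p) p;
      apply; [exact: lt_trans|exact: ltxx].
  move=> y; rewrite mem_undup -[RHS]root_prod_XsubC -pE'.
  by have /(_ y) := roots_on_rootsR p0; rewrite in_itv.
rewrite (perm_big _ pm) /=; apply: eq_bigr => y _.
rewrite pE' mu_prod_XsubC; elim: (count_mem y rs) => [|m IH];
  first by rewrite big_nil.
by rewrite /= big_cons IH; case: m {IH} => //=; rewrite addr0.
Qed.

(** Duality of the spectral and nuclear norms. Inserting the resolution of the identity attached to
    [A^T *m A] turns the pairing into a sum of the forms of [M] at [(A a_k, a_k)] and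
    [(A b_k, b_k)]. Since |A a_k|^2 + |A b_k|^2 = [r k] and |a_k|^2 + |b_k|^2 = 1, Cauchy-Schwarz
    bounds the [k]-th term by [c * Num.sqrt (r k)]. *)
Lemma mxdot_le_nuclear (R : realType) n (A : 'M[R]_n) (M : 'I_n -> 'I_n -> R)
  (c : R) : 0 <= c ->
  opbound M c -> \sum_i \sum_j A i j * M i j <= c * nuclear_norm A.
Proof.
move=> c0 Mc.
have [|a [b [r [ort rE nrm /nuclear_normE ->]]]] :=
  @symmetric_spectral R n (A^T *m A); first by rewrite trmx_mul trmxK.
pose Av (v : 'M[R]_n) k i := \sum_j A i j * v k j.
have -> : \sum_i \sum_j A i j * M i j =
    \sum_k (bilin M (Av a k) (a k) + bilin M (Av b k) (b k)).
  under [RHS]eq_bigr => k _.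
    rewrite /bilin -big_split /=.
    under eq_bigr => i _.
      rewrite -big_split /=.
      under eq_bigr => l _.
        rewrite (_ : _ + _ = \sum_j M i l * A i j * (a k j * a k l + b k j * b
          k l)); last first.
          rewrite /Av -!mulrA !mulr_suml !mulr_sumr -big_split /=.
          by apply: eq_bigr => j _; ring.
        over.
      over.
    over.
  rewrite [RHS]exchange_big /=; apply: eq_bigr => i _.
  rewrite [RHS]exchange_big /=; apply: eq_bigr => l _.
  rewrite [RHS]exchange_big /= (bigD1 l)//= -mulr_sumr ort eqxx mulr1 big1
    ?addr0 1?mulrC// => j jl.
  by rewrite -mulr_sumr ort (negbTE jl) mulr0.
rewrite mulr_sumr; apply: ler_sum => k _.
have rE' : r k = sqsum (Av a k) + sqsum (Av b k).
  rewrite -rE /sqsum -big_split /=.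
  under [RHS]eq_bigr => m _.
    rewrite !expr2 {1}/Av {2}/Av mulr_suml.
    rewrite [X in _ + X](_ : _ = \sum_j A m j * b k j * Av b k m);
      last by rewrite -mulr_suml.
    rewrite -big_split /=.
    under eq_bigr => i _.
      rewrite (_ : _ + _ = \sum_j A m i * A m j * (a k i * a k j + b k i * b k
        j)); last first.
        by rewrite !mulr_sumr -big_split /=; apply: eq_bigr => j _; ring.
      over.
    over.
  rewrite [RHS]exchange_big; apply: eq_bigr => i _ /=.
  rewrite [RHS]exchange_big; apply: eq_bigr => j _ /=.
  rewrite mxE mulr_suml; apply: eq_bigr => m _; by rewrite mxE.
have nrm' : sqsum (a k) + sqsum (b k) = 1 by rewrite -(nrm k) -big_split.
apply: le_trans (lerD (Mc _ _) (Mc _ _)) _.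
rewrite -mulrDr ler_wpM2l// rE'.
set s := sqsum _ in nrm' *; set t := sqsum _ in nrm' *; set s' := sqsum _;
  set t' := sqsum _.
have [s0 t0 s'0 t'0] : [/\ 0 <= s, 0 <= t, 0 <= s' & 0 <= t'] by split;
  exact: sqsum_ge0.
have -> : s' + t' = Num.sqrt s' ^+ 2 + Num.sqrt t' ^+ 2 by rewrite !sqr_sqrtr.
have := nrm'; rewrite -{1}(sqr_sqrtr s0) -{1}(sqr_sqrtr t0).
move: (Num.sqrt s) (Num.sqrt t) (Num.sqrt s') (Num.sqrt t')
  (sqrtr_ge0 s) (sqrtr_ge0 t) (sqrtr_ge0 s') (sqrtr_ge0 t').
move=> x y x' y' x0 y0 x'0 y'0 xy1.
(* Cauchy-Schwarz in the plane, by the Lagrange identity. *)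
rewrite -[leLHS]ger0_norm ?addr_ge0 ?mulr_ge0// -sqrtr_sqr ler_wsqrtr//.
have -> : x' ^+ 2 + y' ^+ 2 = (x' ^+ 2 + y' ^+ 2) * (x ^+ 2 + y ^+ 2) by
  rewrite xy1 mulr1.
rewrite -subr_ge0 (_ : _ - _ = (x' * y - y' * x) ^+ 2) ?sqr_ge0//; ring.
Qed.

(** * Discrepancy and spectral norm *)

Section Level.
Variable R : realType.
Implicit Types t : R.

Lemma level_subproof t : exists a : nat, `|t| <= 2 ^+ a.
Proof.
by exists (Num.bound `|t|); exact/ltW/upper_nthrootP.
Qed.

(** All values of modulus at most 1 share level 0. The vectors measured this way are rescaled to
    have square sum at most [m] on at most [m] coordinates, so these small values cost no more than
    the others. *)
Definition level t : nat := ex_minn (level_subproof t).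

Lemma le_level t : `|t| <= 2 ^+ level t.
Proof. by rewrite /level; case: ex_minnP. Qed.

Lemma level_gt t a : (a < level t)%N -> 2 ^+ a < `|t|.
Proof.
rewrite /level; case: ex_minnP => b _ mb ab; rewrite ltNge.
by apply/negP => /mb; rewrite leqNgt ab.
Qed.

(** The summand 1 covers level 0; at a positive level minimality gives [|t|] larger than half of
    [2 ^+ level t]. *)
Lemma exp4_level t : 4 ^+ level t <= 1 + 4 * t ^+ 2.
Proof.
case E : (level t) => [|a]; first by rewrite expr0 lerDl mulr_ge0 ?sqr_ge0.
have /ltW ta : 2 ^+ a < `|t| by apply: level_gt; rewrite E.
rewrite exprS (le_trans (_ : _ <= 4 * t ^+ 2)) ?lerDr//.
rewrite ler_pM2l// -real_normK ?num_real// (_ : 4 = 2 ^+ 2) -?exprM 1?mulnC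
  ?exprM; last by rewrite -natrX.
by rewrite lerXn2r// nnegrE exprn_ge0.
Qed.

Lemma level_bound (I : finType) (x : I -> R) :
  exists M : nat, forall i, (level (x i) < M)%N.
Proof.
by exists (\max_i level (x i)).+1 => i; rewrite ltnS leq_bigmax.
Qed.

Lemma sum_fiber (I : finType) (f : I -> nat) M (F : I -> R) :
  (forall i, (f i < M)%N) ->
  \sum_i F i = \sum_(a < M) \sum_i (f i == a)%:R * F i.
Proof.
move=> fM; rewrite exchange_big; apply: eq_bigr => i _ /=.
rewrite (bigD1 (Ordinal (fM i)))//= eqxx mul1r big1 ?addr0// => a.
by rewrite -val_eqE /= eq_sym => /negbTE ->; rewrite mul0r.
Qed.

Lemma sum_fiber2 (I J : finType) (f : I -> nat) (g : J -> nat) M N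
    (P : nat -> nat -> bool) (F : I -> J -> R) :
  (forall i, (f i < M)%N) -> (forall j, (g j < N)%N) ->
  \sum_i \sum_j (P (f i) (g j))%:R * F i j =
  \sum_(a < M) \sum_(b < N) (P a b)%:R *
    \sum_i \sum_j ((f i == a)%:R * (g j == b)%:R) * F i j.
Proof.
move=> fM gN; rewrite (sum_fiber _ fM); apply: eq_bigr => a _.
under eq_bigr => i _ do rewrite (sum_fiber _ gN) mulr_sumr.
rewrite exchange_big; apply: eq_bigr => b _ /=.
rewrite mulr_sumr; apply: eq_bigr => i _; rewrite !mulr_sumr.
apply: eq_bigr => j _; case: (f i =P a) => [->|_]; last by rewrite !mul0r mulr0.
by case: (g j =P b) => [->|_]; rewrite ?(mul0r, mulr0)//= !mul1r.
Qed.

End Level.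

Section Rounding.
Variable R : realType.

(** The indices where [g] is nonnegative and those where it is negative form two admissible subsets
    [U]. *)
Lemma sum_norm_le (I : finType) (X : {set I}) (g : I -> R) c :
  (forall U : {set I}, U \subset X -> `|\sum_(i in U) g i| <= c) ->
  \sum_(i in X) `|g i| <= 2 * c.
Proof.
move=> H; rewrite (bigID (fun i => 0 <= g i)) /= mulr_natl mulr2n.
apply: lerD.
  apply: le_trans (H [set i in X | 0 <= g i] _); last first.
    by apply/fintype.subsetP => i; rewrite inE => /andP[].
  rewrite big_mkcond /= [X in _ <= `|X|]big_mkcond /=.
  apply: le_trans (ler_norm _); apply: ler_sum => i _; rewrite inE.
  by case: (i \in X); case: (lerP 0 (g i)) => //= ?; rewrite ger0_norm.
apply: le_trans (H [set i in X | ~~ (0 <= g i)] _); last first.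
  by apply/fintype.subsetP => i; rewrite inE => /andP[].
rewrite -normrN -sumrN; apply: le_trans (ler_norm _).
rewrite big_mkcond /= [leRHS]big_mkcond /=.
apply: ler_sum => i _; rewrite inE.
by case: (i \in X); case: (lerP 0 (g i)) => //= ?; rewrite ltr0_norm.
Qed.

Lemma sum_weight_le (I : finType) (X : {set I}) (g x : I -> R) s c :
  (forall i, i \in X -> `|x i| <= s) ->
  (forall U : {set I}, U \subset X -> `|\sum_(i in U) g i| <= c) ->
  0 <= s -> `|\sum_(i in X) g i * x i| <= 2 * (s * c).
Proof.
move=> xs H s0; apply: le_trans (ler_norm_sum _ _ _) _.
rewrite mulrCA; apply: le_trans (ler_wpM2l s0 (sum_norm_le H)).
rewrite mulr_sumr; apply: ler_sum => i iX.
by rewrite normrM mulrC ler_wpM2r// xs.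
Qed.

(** Extends a discrepancy bound from indicator functions to bounded weights; the sign splitting
    costs a factor 2 in each variable. *)
Lemma block_sum_le (I J : finType) (X : {set I}) (Y : {set J})
    (B : I -> J -> R) (x : I -> R) (y : J -> R) s t c :
  (forall i, i \in X -> `|x i| <= s) -> (forall j, j \in Y -> `|y j| <= t) ->
  0 <= s -> 0 <= t ->
  (forall (U : {set I}) (V : {set J}), U \subset X -> V \subset Y ->
    `|\sum_(i in U) \sum_(j in V) B i j| <= c) ->
  `|\sum_(i in X) \sum_(j in Y) B i j * x i * y j| <= 4 * (s * t * c).
Proof.
move=> xs yt s0 t0 H.
have -> : \sum_(i in X) \sum_(j in Y) B i j * x i * y j =
    \sum_(i in X) (\sum_(j in Y) B i j * y j) * x i.
  apply: eq_bigr => i _; rewrite mulr_suml; apply: eq_bigr => j _.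
  by rewrite mulrAC.
rewrite (_ : 4 * _ = 2 * (s * (2 * (t * c)))); last by ring.
apply: sum_weight_le => // U UX.
rewrite exchange_big /=; under eq_bigr => j _ do rewrite -mulr_suml.
apply: sum_weight_le => // V VY.
by rewrite exchange_big /= H.
Qed.

End Rounding.

Definition near_levels (g a b : nat) : bool := (a <= b + g)%N && (b <= a + g)%N.

Lemma near_levelsC g a b : near_levels g a b = near_levels g b a.
Proof. by rewrite /near_levels andbC. Qed.

Lemma card_near_levels (R : realType) g a M :
  \sum_(b < M) (near_levels g a b)%:R <= (2 * g + 1)%:R :> R.
Proof.
rewrite -natr_sum ler_nat -(big_mkord xpredT (fun b => near_levels g a b :
  nat)).
have -> : (\sum_(0 <= b < M) near_levels g a b =
    size [seq b <- iota 0 M | near_levels g a b])%N.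
  rewrite size_filter -sum1_count /index_iota subn0 [RHS]big_mkcond.
  by apply: eq_bigr => b _; case: near_levels.
rewrite -[leqRHS](size_iota (a - g)); apply: uniq_leq_size.
  by rewrite filter_uniq// iota_uniq.
by move=> b; rewrite mem_filter !mem_iota /near_levels => /andP[/andP[? ?] _];
  lia.
Qed.

Lemma sum_fiber_card (R : realType) (I : finType) (f : I -> nat) M (c : nat ->
  R) :
  (forall i, (f i < M)%N) ->
  \sum_(a < M) c a * #|[set i | f i == a]|%:R = \sum_i c (f i).
Proof.
move=> fM; rewrite (sum_fiber _ fM); apply: eq_bigr => a _.
rewrite -sum1_card natr_sum mulr_sumr big_mkcond.
by apply: eq_bigr => i _; rewrite inE; case: eqP => [->|];
  rewrite ?mul0r// mul1r mulr1.
Qed.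

(* Following Bilu and Linial: pairs of coordinates on close dyadic levels are
   controlled by the discrepancy, and on distant levels the larger coordinate
   dominates so much that the crude bound on row sums suffices. *)
Lemma inverse_mixing (R : realType) (I J : finType) (B : I -> J -> R)
    (m al D : R) (g : nat) :
  0 < m -> 0 <= al -> 0 <= D -> #|I|%:R <= m -> #|J|%:R <= m ->
  (forall (U : {set I}) (V : {set J}),
     `|\sum_(i in U) \sum_(j in V) B i j| <= al * Num.sqrt (#|U|%:R * #|V|%:R))
       ->
  (forall i, \sum_j `|B i j| <= D) -> (forall j, \sum_i `|B i j| <= D) ->
  opbound B (20 * al * (2 * g + 1)%:R + 2 * D / 2 ^+ g).
Proof.
move=> m0 al0 D0 Im Jm disc row col.
(* Both vectors are scaled by the square root of [m], so that coordinates of average size are about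
   1, the top of level 0. *)
suff H (X : I -> R) (Y : J -> R) : sqsum X <= m -> sqsum Y <= m ->
    bilin B X Y <= m * (20 * al * (2 * g + 1)%:R + 2 * D / 2 ^+ g).
  apply: opbound_unit => x y x1 y1.
  have sc (K : finType) (z : K -> R) : sqsum z <= 1 -> sqsum (fun k => Num.sqrt
    m * z k) <= m.
    move=> z1; rewrite /sqsum; under eq_bigr do rewrite exprMn sqr_sqrtr ?ltW//.
    by rewrite -mulr_sumr ger_pMr.
  have := H _ _ (sc _ _ x1) (sc _ _ y1).
  by rewrite bilinZ -expr2 (sqr_sqrtr (ltW m0)) ler_pM2l.
move=> Xm Ym.
have [M HM] := level_bound X; have [N HN] := level_bound Y.
pose f i := level (X i); pose h j := level (Y j).
have -> : bilin B X Y =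
    \sum_i \sum_j (near_levels g (f i) (h j))%:R * (B i j * X i * Y j) +
    \sum_i \sum_j (~~ near_levels g (f i) (h j))%:R * (B i j * X i * Y j).
  rewrite -big_split; apply: eq_bigr => i _; rewrite -big_split;
    apply: eq_bigr => j _ /=.
  by rewrite -mulrDl; case: near_levels; rewrite ?addr0 ?add0r mul1r.
rewrite mulrDr; apply: lerD; last first.
  (* When the levels differ by more than [g], the larger coordinate is at least [2 ^+ g] times the
     smaller, and its square dominates. *)
  have far i j : ~~ near_levels g (f i) (h j) -> 2 ^+ g * (`|X i| * `|Y j|) <=
    X i ^+ 2 + Y j ^+ 2.
    have aux (x y : R) : (level x + g < level y)%N -> 2 ^+ g * (`|x| * `|y|) <=
      x ^+ 2 + y ^+ 2.
      move=> /level_gt /ltW; rewrite exprD => xy.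
      rewrite mulrA; apply: (@le_trans _ _ (`|y| * `|y|)).
        rewrite ler_wpM2r// (le_trans _ xy)// mulrC ler_wpM2r ?le_level//.
      by rewrite -expr2 real_normK ?num_real// lerDr sqr_ge0.
    rewrite /near_levels negb_and -!ltnNge => /orP[] /aux //.
    by rewrite addrC (mulrC `|X i|).
  apply: (@le_trans _ _ ((2 ^+ g)^-1 * \sum_i \sum_j (`|B i j| * X i ^+ 2 + `|B
    i j| * Y j ^+ 2))).
    rewrite mulr_sumr; apply: ler_sum => i _; rewrite mulr_sumr;
      apply: ler_sum => j _.
    have rhs0 : 0 <= (2 ^+ g)^-1 * (`|B i j| * X i ^+ 2 + `|B i j| * Y j ^+ 2).
      by rewrite mulr_ge0 ?invr_ge0 ?exprn_ge0// addr_ge0// mulr_ge0// sqr_ge0.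
    case E : (~~ near_levels _ _ _); last by rewrite mul0r.
    rewrite mul1r (le_trans (ler_norm _))// !normrM -mulrDr mulrCA -mulrA
      ler_wpM2l//.
    by rewrite ler_pdivlMl ?exprn_gt0// far.
  under eq_bigr do rewrite big_split.
  rewrite big_split /= [X in _ * (_ + X)]exchange_big /=.
  rewrite [leRHS](_ : _ = (2 ^+ g)^-1 * (m * D + m * D)); last by ring.
  have ineq (K L : finType) (b : K -> L -> R) z : sqsum z <= m -> (forall k,
    \sum_l `|b k l| <= D) ->
      \sum_k \sum_l `|b k l| * z k ^+ 2 <= m * D.
    move=> zm bD; apply: (@le_trans _ _ (sqsum z * D));
      last by rewrite ler_wpM2r.
    rewrite /sqsum mulr_suml; apply: ler_sum => k _; rewrite -mulr_suml mulrC.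
    by rewrite ler_wpM2l ?sqr_ge0.
  rewrite ler_wpM2l ?invr_ge0 ?exprn_ge0//.
  by apply: lerD; [exact: ineq Xm row|exact: (ineq _ _ (fun j i => B i j) _ Ym
    col)].
rewrite (sum_fiber2 _ _ HM HN).
pose p a : R := 4 ^+ a * #|[set i | f i == a]|%:R.
pose q b : R := 4 ^+ b * #|[set j | h j == b]|%:R.
have four a : 4 ^+ a = 2 ^+ a * 2 ^+ a :> R by rewrite -exprMn -natrM.
(* On one block of levels, [block_sum_le] gives 4 [al] times a product of two square roots, which
   the arithmetic-geometric mean inequality splits into [p a] and [q b]. Each of these sums to at
   most [5 * m], and each level has at most [2 * g + 1] near partners, whence the constant 20. *)
apply: (@le_trans _ _ (\sum_(a < M) \sum_(b < N) (near_levels g a b)%:R * (2 *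
  al * (p a + q b)))).
  apply: ler_sum => a _; apply: ler_sum => b _; rewrite ler_wpM2l//.
  rewrite [leLHS](_ : _ = \sum_(i in [set i | f i == a]) \sum_(j in [set j | h
    j == b]) B i j * X i * Y j); last first.
    rewrite [RHS]big_mkcond; apply: eq_bigr => i _; rewrite inE.
    case: eqP => _; last by rewrite big1// => j _; rewrite !mul0r.
    rewrite [RHS]big_mkcond; apply: eq_bigr => j _; rewrite inE mul1r.
    by case: eqP; rewrite ?mul1r ?mul0r.
  apply: le_trans (ler_norm _) _.
  set U := [set i | _]; set V := [set j | _].
  apply: le_trans (@block_sum_le R I J U V B X Y (2 ^+ a) (2 ^+ b) (al *
    Num.sqrt (#|U|%:R * #|V|%:R)) _ _ _ _ _) _.
  - by move=> i; rewrite inE => /eqP <-; exact: le_level.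
  - by move=> i; rewrite inE => /eqP <-; exact: le_level.
  - by rewrite exprn_ge0.
  - by rewrite exprn_ge0.
  - move=> U' V' UU VV; apply: le_trans (disc _ _) _;
      rewrite ler_wpM2l// ler_wsqrtr//.
    by rewrite ler_pM// ler_nat subset_leq_card.
  rewrite /p /q -/U -/V !four sqrtrM//.
  rewrite -{2}[#|U|%:R]sqr_sqrtr// -{2}[#|V|%:R]sqr_sqrtr//.
  rewrite -subr_ge0 [leRHS](_ : _ = 2 * al * (2 ^+ a * Num.sqrt #|U|%:R - 2 ^+
    b * Num.sqrt #|V|%:R) ^+ 2); last by ring.
  by apply: mulr_ge0; [exact: mulr_ge0|exact: sqr_ge0].
have sump (K : finType) (z : K -> R) N' : #|K|%:R <= m -> sqsum z <= m ->
  (forall k, (level (z k) < N')%N) ->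
  \sum_(b < N') 4 ^+ b * #|[set k | level (z k) == b]|%:R <= 5 * m.
  move=> Km zm zN; rewrite sum_fiber_card//.
  apply: (@le_trans _ _ (\sum_k (1 + 4 * z k ^+ 2))).
    by apply: ler_sum => k _; exact: exp4_level.
  rewrite big_split /= -mulr_sumr -/(sqsum z) sumr_const cardT -cardE.
  rewrite (_ : 5 * m = m + 4 * m); last by ring.
  by apply: lerD => //; rewrite ler_wpM2l.
rewrite [leLHS](_ : _ = 2 * al * (\sum_(a < M) p a * \sum_(b < N) (near_levels
  g a b)%:R
   + \sum_(b < N) q b * \sum_(a < M) (near_levels g b a)%:R)); last first.
  have -> : \sum_(b < N) q b * (\sum_(a < M) (near_levels g b a)%:R) = \sum_(a
    < M) \sum_(b < N) q b * (near_levels g b a)%:R.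
    by rewrite exchange_big; apply: eq_bigr => b _; rewrite mulr_sumr.
  rewrite -big_split mulr_sumr; apply: eq_bigr => a _ /=.
  rewrite mulr_sumr -big_split mulr_sumr; apply: eq_bigr => b _ /=.
  by rewrite (near_levelsC g b a); ring.
have bd (N1 N2 : nat) (r : nat -> R) : (forall a, 0 <= r a) -> \sum_(a < N1) r
  a <= 5 * m ->
   \sum_(a < N1) r a * (\sum_(b < N2) (near_levels g a b)%:R) <= 5 * m * (2 * g
     + 1)%:R.
  move=> r0 rm; apply: (@le_trans _ _ (\sum_(a < N1) r a * (2 * g + 1)%:R)).
    by apply: ler_sum => a _; rewrite ler_wpM2l// card_near_levels.
  by rewrite -mulr_suml ler_wpM2r.
have p0 a : 0 <= p a by rewrite /p mulr_ge0 ?exprn_ge0.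
have q0 a : 0 <= q a by rewrite /q mulr_ge0 ?exprn_ge0.
apply: le_trans (ler_wpM2l _ (lerD (bd _ _ _ p0 (sump _ _ _ Im Xm HM)) (bd _ _
  _ q0 (sump _ _ _ Jm Ym HN)))) _.
  by rewrite mulr_ge0.
by rewrite le_eqVlt; apply/orP; left; apply/eqP; ring.
Qed.

(** * Light and heavy pairs *)

Lemma sum_pow2_level (R : realType) L a N :
  \sum_(b < N) (a + b <= L)%N%:R * 2 ^+ (a + b) <= 2 ^+ L.+1 :> R.
Proof.
(* The bound is strengthened to one that follows the partial geometric sums, so that induction on
   [N] goes through. *)
suff : \sum_(b < N) (a + b <= L)%N%:R * 2 ^+ (a + b) <=
    2 ^+ minn (a + N) L.+1 :> R.
  by move=> /le_trans; apply; rewrite ler_weXn2l ?ler1n// geq_minr.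
elim: N => [|N IH]; first by rewrite big_ord0 exprn_ge0.
rewrite big_ord_recr /=; apply: le_trans (lerD IH (lexx _)) _.
case: (leqP (a + N) L) => aN; last first.
  by rewrite mul0r addr0 ler_weXn2l ?ler1n//; lia.
rewrite mul1r (minn_idPl _) ?(leq_trans aN)// (minn_idPl _) ?addnS//.
by rewrite exprS mulr_natl mulr2n.
Qed.

(* The Schur test, with weight [2 ^+ (a + b)] on the pair of levels [(a, b)]. *)
Lemma light_opbound (R : realType) (I J : finType) (B : I -> J -> R) (be : R)
    (X : I -> R) (Y : J -> R) L :
  0 <= be -> opbound B be ->
  opbound (fun i j => (level (X i) + level (Y j) <= L)%N%:R * (B i j * X i * Y
    j))
    (be * 2 ^+ L.+1).
Proof.
move=> be0 HB; apply: opbound_unit => w z w1 z1.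
have [M HM] := level_bound X; have [N HN] := level_bound Y.
rewrite (_ : bilin _ w z = \sum_i \sum_j (level (X i) + level (Y j) <= L)%N%:R *
  (B i j * (X i * w i) * (Y j * z j))); last first.
  by apply: eq_bigr => i _; apply: eq_bigr => j _; ring.
rewrite (sum_fiber2 (fun a b => a + b <= L)%N _ HM HN).
pose p (K : finType) (U : K -> R) (v : K -> R) a := \sum_k (level (U k) ==
  a)%:R * v k ^+ 2.
have p0 K U v a : 0 <= p K U v a by apply: sumr_ge0 => k _;
  rewrite mulr_ge0// sqr_ge0.
have loc (K : finType) (U v : K -> R) a :
    sqsum (fun k => (level (U k) == a)%:R * (U k * v k)) <= 4 ^+ a * p K U v a.
  rewrite /sqsum /p mulr_sumr; apply: ler_sum => k _.
  case: eqP => [<-|_]; last by rewrite !mul0r expr0n mulr0.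
  rewrite !mul1r exprMn ler_wpM2r ?sqr_ge0// -real_normK ?num_real//.
  rewrite (_ : 4 = 2 ^+ 2) -?exprM 1?mulnC ?exprM; last by rewrite -natrX.
  by rewrite lerXn2r ?nnegrE ?exprn_ge0// le_level.
(* At levels [a] and [b] the bound on [B] yields [be * 2 ^+ (a + b)] times the geometric mean of the
   masses of [w] and [z] there, replaced by their arithmetic mean. The row and column sums of the
   weights are then given by [sum_pow2_level]. *)
apply: (@le_trans _ _ (\sum_(a < M) \sum_(b < N) (a + b <= L)%N%:R *
    (be * (2 ^+ (a + b) * ((p I X w a + p J Y z b) / 2))))).
  apply: ler_sum => a _; apply: ler_sum => b _; rewrite ler_wpM2l//.
  rewrite [leLHS](_ : _ = bilin B (fun i => (level (X i) == a)%:R * (X i * w i))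
     (fun j => (level (Y j) == b)%:R * (Y j * z j))); last first.
    by apply: eq_bigr => i _; apply: eq_bigr => j _; ring.
  apply: le_trans (HB _ _) _; rewrite ler_wpM2l//.
  apply: (@le_trans _ _ (Num.sqrt (4 ^+ a * p I X w a) * Num.sqrt (4 ^+ b * p J
    Y z b))).
    by rewrite ler_pM ?sqrtr_ge0// ler_wsqrtr// loc.
  have sqrt4 c : Num.sqrt (4 ^+ c) = 2 ^+ c :> R.
    rewrite (_ : 4 = 2 ^+ 2) -?exprM 1?mulnC ?exprM; last by rewrite -natrX.
    by rewrite sqrtr_sqr ger0_norm// exprn_ge0.
  rewrite !sqrtrM ?exprn_ge0// !sqrt4.
  rewrite mulrACA -exprD ler_wpM2l ?exprn_ge0//.
  rewrite -{2}[p I X w a]sqr_sqrtr// -{2}[p J Y z b]sqr_sqrtr//.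
  rewrite -subr_ge0 [leRHS](_ : _ = (Num.sqrt (p I X w a) - Num.sqrt (p J Y z
    b)) ^+ 2 / 2).
    by rewrite mulr_ge0 ?sqr_ge0// invr_ge0.
  by field.
have sump (K : finType) (U v : K -> R) N' : (forall k, (level (U k) < N')%N) ->
  sqsum v <= 1 ->
   \sum_(a < N') p K U v a <= 1.
  by move=> HU v1; rewrite -(sum_fiber _ HU).
rewrite [leLHS](_ : _ = be / 2 * (\sum_(a < M) p I X w a * (\sum_(b < N) (a + b
  <= L)%N%:R * 2 ^+ (a + b))
   + \sum_(b < N) p J Y z b * (\sum_(a < M) (b + a <= L)%N%:R * 2 ^+ (b +
     a)))); last first.
  have -> : \sum_(b < N) p J Y z b * (\sum_(a < M) (b + a <= L)%N%:R * 2 ^+ (b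
    + a)) =
      \sum_(a < M) \sum_(b < N) p J Y z b * ((b + a <= L)%N%:R * 2 ^+ (b + a)).
    by rewrite exchange_big; apply: eq_bigr => b _; rewrite mulr_sumr.
  rewrite -big_split mulr_sumr; apply: eq_bigr => a _ /=.
  rewrite mulr_sumr -big_split mulr_sumr; apply: eq_bigr => b _ /=.
  by rewrite (addnC b a); field.
have bd (K : finType) (U v : K -> R) N1 N2 : (forall k, (level (U k) < N1)%N)
  -> sqsum v <= 1 ->
  \sum_(a < N1) p K U v a * (\sum_(b < N2) (a + b <= L)%N%:R * 2 ^+ (a + b)) <=
    2 ^+ L.+1.
  move=> HU v1; apply: (@le_trans _ _ (\sum_(a < N1) p K U v a * 2 ^+ L.+1)).
    by apply: ler_sum => a _; rewrite ler_wpM2l// sum_pow2_level.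
  by rewrite -mulr_suml ger_pMl ?exprn_gt0// sump.
apply: le_trans (ler_wpM2l _ (lerD (bd _ _ _ _ _ HM w1) (bd _ _ _ _ _ HN z1)))
  _.
  by rewrite mulr_ge0// invr_ge0.
by rewrite le_eqVlt; apply/orP; left; apply/eqP; field.
Qed.

(** The modulus of [B] is replaced by [B + 2 q]. The part with [B] splits into [L + 2] bilinear
    forms of truncated vectors, each at most [be * m]. In the part with [q], heaviness bounds the
    product of the coordinates by [2 ^- L] times an expression in their squares, of total at most
    [4 * m ^+ 2]. *)
Lemma heavy_sum_le (R : realType) (I J : finType) (B : I -> J -> R) (be q m : R)
    (X : I -> R) (Y : J -> R) L :
  0 <= be -> opbound B be -> 0 <= q -> 0 <= m ->
  (forall i j, `|B i j| <= B i j + 2 * q) ->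
  #|I|%:R <= m -> #|J|%:R <= m -> sqsum X <= m -> sqsum Y <= m ->
  \sum_i \sum_j (L < level (X i) + level (Y j))%N%:R * (`|B i j| * `|X i| * `|Y
    j|)
    <= (L + 2)%:R * be * m + 8 * q * m ^+ 2 / 2 ^+ L.
Proof.
move=> be0 HB q0 m0 Bq Im Jm Xm Ym.
apply: (@le_trans _ _ (\sum_i \sum_j ((L < level (X i) + level (Y j))%N%:R * (B
  i j * `|X i| * `|Y j|)
   + 2 * q / 2 ^+ L * (X i ^+ 2 + Y j ^+ 2 + 2 * (X i ^+ 2 * Y j ^+ 2))))).
  apply: ler_sum => i _; apply: ler_sum => j _.
  case: (ltnP L) => heavy; last first.
    rewrite !mul0r add0r; apply: mulr_ge0.
      by rewrite divr_ge0 ?mulr_ge0 ?exprn_ge0.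
    by rewrite !addr_ge0 ?sqr_ge0// mulr_ge0// mulr_ge0 ?sqr_ge0.
  rewrite !mul1r.
  have XY : `|X i| * `|Y j| <= (2 ^+ L)^-1 * (X i ^+ 2 + Y j ^+ 2 + 2 * (X i ^+
    2 * Y j ^+ 2)).
    rewrite ler_pdivlMl ?exprn_gt0//.
    (* If one coordinate has level 0 it is at most 1 and the other exceeds [2 ^+ L]. If the levels
       are [a.+1] and [b.+1], the moduli exceed [2 ^+ a] and [2 ^+ b], with [L <= (a + b).+1]. *)
    have one (x y : R) : (L < level y)%N -> level x = 0 -> 2 ^+ L * (`|x| *
      `|y|) <= y ^+ 2.
      move=> /level_gt/ltW Ly x0; have := le_level x; rewrite x0 expr0 => x1.
      rewrite -[y ^+ 2]real_normK ?num_real// expr2 mulrA ler_wpM2r//.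
      by rewrite (le_trans _ Ly)// ger_pMr ?exprn_gt0.
    have XY0 : 0 <= X i ^+ 2 * Y j ^+ 2 by rewrite mulr_ge0 ?sqr_ge0.
    have X0 := sqr_ge0 (X i); have Y0 := sqr_ge0 (Y j).
    case Ea : (level (X i)) => [|a].
      have := one (X i) (Y j); rewrite Ea add0n in heavy *;
        move=> /(_ heavy erefl); lra.
    case Eb : (level (Y j)) => [|b].
      have := one (Y j) (X i); rewrite Ea Eb addn0 in heavy *;
        move=> /(_ heavy erefl); rewrite (mulrC `|Y j|); lra.
    have /ltW Xa : 2 ^+ a < `|X i| by apply: level_gt; rewrite Ea.
    have /ltW Yb : 2 ^+ b < `|Y j| by apply: level_gt; rewrite Eb.
    suff : 2 ^+ L * (`|X i| * `|Y j|) <= 2 * (X i ^+ 2 * Y j ^+ 2) by lra.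
    rewrite -[X i ^+ 2]real_normK ?num_real// -[Y j ^+ 2]real_normK ?num_real//.
    rewrite -exprMn expr2 [leRHS]mulrA ler_wpM2r ?mulr_ge0//.
    apply: (@le_trans _ _ (2 * (2 ^+ a * 2 ^+ b))).
      rewrite -exprD -exprS ler_weXn2l ?ler1n//.
      by move: heavy; rewrite Ea Eb addSn ltnS addnS.
    by rewrite ler_wpM2l// ler_pM ?exprn_ge0.
  apply: (@le_trans _ _ ((B i j + 2 * q) * (`|X i| * `|Y j|))).
    by rewrite -mulrA ler_wpM2r ?mulr_ge0.
  rewrite mulrDl [B i j * (_ * _)]mulrA lerD2l -(mulrA (2 * q)) ler_wpM2l//
    mulr_ge0//.
under eq_bigr do rewrite big_split /=.
rewrite big_split /=; apply: lerD.
  (* Above [L] every level of [X] makes the pair heavy, so capping at [L.+1] loses nothing and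
     leaves only [L + 2] classes. *)
  pose f i := minn (level (X i)) L.+1.
  have fM i : (f i < L + 2)%N by rewrite addn2 ltnS geq_minr.
  have [N HN] := level_bound Y.
  rewrite (_ : \sum_i _ = \sum_(a < L + 2) bilin B (fun i => (f i == a)%:R *
    `|X i|)
      (fun j => (L < a + level (Y j))%N%:R * `|Y j|)); last first.
    rewrite (sum_fiber _ fM); apply: eq_bigr => a _; apply: eq_bigr => i _.
    rewrite /=; case: eqP => [<-|_]; last by rewrite mul0r big1// => j _;
      rewrite !(mul0r, mulr0).
    rewrite !mul1r; apply: eq_bigr => j _.
    have -> : (L < f i + level (Y j))%N = (L < level (X i) + level (Y j))%N by
      rewrite /f; lia.
    by rewrite mulrCA.
  apply: (@le_trans _ _ (\sum_(a < L + 2) be * m)); last first.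
    by rewrite sumr_const card_ord -[be * m *+ _]mulr_natl mulrA.
  apply: ler_sum => a _; apply: le_trans (HB _ _) _; rewrite ler_wpM2l//.
  have sub (K : finType) (b : K -> bool) (Z : K -> R) : sqsum Z <= m ->
      Num.sqrt (sqsum (fun k => (b k)%:R * `|Z k|)) <= Num.sqrt m.
    move=> Zm; rewrite ler_wsqrtr//; apply: le_trans Zm; apply: ler_sum => k _.
    by case: (b k); rewrite ?mul1r ?mul0r ?real_normK ?num_real// expr0n
      sqr_ge0.
  rewrite -[leRHS](sqr_sqrtr m0) expr2 ler_pM ?sqrtr_ge0//.
    exact: (sub _ (fun i => f i == a)).
  exact: (sub _ (fun j => (L < a + level (Y j))%N)).
under eq_bigr do rewrite -mulr_sumr.
rewrite -mulr_sumr.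
rewrite [leRHS](_ : _ = 2 * q / 2 ^+ L * (m * m + m * m + 2 * (m * m)));
  last by field; rewrite expf_neq0.
rewrite ler_wpM2l ?mulr_ge0 ?invr_ge0 ?exprn_ge0//.
rewrite [leLHS](_ : _ = sqsum X * #|J|%:R + #|I|%:R * sqsum Y + 2 * (sqsum X *
  sqsum Y)).
  have X0 := sqsum_ge0 X; have Y0 := sqsum_ge0 Y.
  by rewrite !lerD ?ler_wpM2l ?ler_pM.
under eq_bigr do rewrite !big_split /=.
rewrite !big_split /= !sumr_const; congr (_ + _ + _).
- under eq_bigr do rewrite sumr_const -mulr_natr; by rewrite -mulr_suml.
- by rewrite mulr_natl.
- under eq_bigr do rewrite -mulr_sumr -mulr_sumr;
    by rewrite -mulr_sumr -mulr_suml.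
Qed.

(** After scaling by the square root of [n], the light pairs are bounded by duality and the heavy
    ones through the entry bound on [A]. Three error terms arise, and the constants make each at
    most a quarter of the target. *)
Lemma sampling_error (R : realType) n (A : 'M[R]_n) (B : 'I_n -> 'I_n -> R)
    (q be eps : R) (x y : 'I_n -> R) : (0 < n)%N ->
  0 < eps -> eps < 1 -> 0 <= q -> bounded_entries A ->
  (forall i j, `|B i j| <= B i j + 2 * q) -> 0 <= be -> opbound B be ->
  be <= eps ^+ 2 * (q * n%:R) / 512 ->
  sqsum x <= 1 -> sqsum y <= 1 ->
  \sum_i \sum_j A i j * B i j * x i * y j
    <= q * eps * Num.max n%:R (nuclear_norm A).
Proof.
move=> n0 e0 e1 q0 A1 Bq be0 HB bee x1 y1.
have nR0 : 0 < n%:R :> R by rewrite ltr0n.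
pose rho : R := Num.sqrt n%:R.
have rho2 : rho * rho = n%:R by rewrite -expr2 sqr_sqrtr.
pose X i := rho * x i; pose Y i := rho * y i.
have sc (z : 'I_n -> R) : sqsum z <= 1 -> sqsum (fun k => rho * z k) <= n%:R.
  move=> z1; rewrite /sqsum; under eq_bigr do rewrite exprMn expr2 rho2.
  by rewrite -mulr_sumr ger_pMr.
have Xm : sqsum X <= n%:R := sc _ x1; have Ym : sqsum Y <= n%:R := sc _ y1.
(* The threshold [2 ^+ L] lies between [32 / eps] and [64 / eps]. The lower bound makes the term in
   [q] small (8/32 = 1/4); the upper bound matches the 512 in the hypothesis on [be] (128/512 =
   1/4). *)
pose L := level (32 / eps).
have e32 : 0 < 32 / eps by rewrite divr_gt0.
have L1 : 32 / eps <= 2 ^+ L by have := le_level (32 / eps);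
  rewrite (gtr0_norm e32).
have L2 : 2 ^+ L <= 64 / eps.
  case E : L => [|l].
    by rewrite expr0 ler_pdivlMr// mul1r; lra.
  have := @level_gt _ (32 / eps) l; rewrite -/L E => /(_ (ltnSn _)).
  rewrite (gtr0_norm e32)// exprS => H; lra.
set mx := Num.max _ _.
have mxn : n%:R <= mx by rewrite le_max lexx.
have mxA : nuclear_norm A <= mx by rewrite le_max lexx orbT.
have mx0 : 0 <= mx by apply: le_trans mxn.
rewrite -(ler_pM2l nR0).
have -> : n%:R * (\sum_i \sum_j A i j * B i j * x i * y j) =
  \sum_i \sum_j A i j * ((level (X i) + level (Y j) <= L)%N%:R * (B i j * X i *
    Y j)) +
  \sum_i \sum_j A i j * ((L < level (X i) + level (Y j))%N%:R * (B i j * X i *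
    Y j)).
  rewrite -big_split mulr_sumr; apply: eq_bigr => i _ /=.
  rewrite -big_split mulr_sumr; apply: eq_bigr => j _ /=.
  by rewrite -mulrDr -mulrDl ltnNge -rho2 /X /Y; case: leqP => _;
    rewrite /= ?(addr0, add0r) mul1r; ring.
have light := mxdot_le_nuclear A (mulr_ge0 be0 (exprn_ge0 L.+1 (ler0n _ 2)))
  (light_opbound X Y L be0 HB).
have cI : #|'I_n|%:R <= n%:R :> R by rewrite card_ord.
have heavy := heavy_sum_le L be0 HB q0 (ltW nR0) Bq cI cI Xm Ym.
apply: le_trans (lerD light (_ : _ <= (L + 2)%:R * be * n%:R + 8 * q * n%:R ^+
  2 / 2 ^+ L)) _.
  apply: le_trans heavy; apply: ler_sum => i _; apply: ler_sum => j _.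
  rewrite (le_trans (ler_norm _))// normrM -[leRHS]mul1r ler_pM//.
  by rewrite !normrM normr_nat.
have pL : 0 < 2 ^+ L :> R by rewrite exprn_gt0.
have h1 : be * 2 ^+ L.+1 <= n%:R * (q * eps) / 4.
  rewrite exprS; apply: (@le_trans _ _ (eps ^+ 2 * (q * n%:R) / 512 * (2 * (64
    / eps)))).
    by apply: ler_pM => //; rewrite ler_pM2l.
  by rewrite le_eqVlt; apply/orP; left; apply/eqP; field; rewrite gt_eqF.
have h2 : (L + 2)%:R * be <= n%:R * (q * eps) / 4.
  apply: le_trans h1; rewrite mulrC ler_wpM2l// -natrX ler_nat expnS.
  by rewrite mul2n -addnn addn2 -addn1 leq_add ?expn_gt0// ltn_expl.
have h3 : 8 * q * n%:R ^+ 2 / 2 ^+ L <= n%:R * (q * eps * mx) / 4.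
  rewrite ler_pdivrMr//.
  apply: (@le_trans _ _ (n%:R * (q * eps * n%:R) / 4 * (32 / eps))).
    by rewrite le_eqVlt; apply/orP; left; apply/eqP; field; rewrite gt_eqF.
  apply: ler_pM => //; [|exact: ltW|].
    by rewrite !mulr_ge0 ?invr_ge0// ltW.
  by rewrite ler_wpM2r ?invr_ge0// ler_wpM2l// ler_wpM2l// mulr_ge0// ltW.
have h1' : be * 2 ^+ L.+1 * nuclear_norm A <= n%:R * (q * eps * mx) / 4.
  rewrite (le_trans (ler_wpM2l _ mxA))//; first by rewrite mulr_ge0// exprn_ge0.
  by rewrite (le_trans (ler_wpM2r mx0 h1))// le_eqVlt; apply/orP; left;
    apply/eqP; ring.
have h2' : (L + 2)%:R * be * n%:R <= n%:R * (q * eps * mx) / 4.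
  rewrite (le_trans (ler_wpM2l _ mxn))//; first by rewrite mulr_ge0.
  by rewrite (le_trans (ler_wpM2r mx0 h2))// le_eqVlt; apply/orP; left;
    apply/eqP; ring.
have : 0 <= n%:R * (q * eps * mx) by rewrite !mulr_ge0// ltW.
lra.
Qed.

(** * Random sets of low discrepancy *)

Section Random.
Variable R : realType.

(** The moment generating function of a centred Bernoulli variable is at most that of a centred
    Poisson variable, by 1 + u <= exp u at u = p (exp l - 1). *)
Lemma expR_mgf_le (p l : R) : 0 <= p -> p <= 1 ->
  p * expR (l * (1 - p)) + (1 - p) * expR (l * (0 - p)) <=
  expR (p * (expR l - 1 - l)).
Proof.
move=> p0 p1.
have -> : p * expR (l * (1 - p)) + (1 - p) * expR (l * (0 - p)) =
    expR (- (l * p)) * (1 + p * (expR l - 1)).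
  rewrite mulrBr mulr1 sub0r mulrN expRD; ring.
have -> : p * (expR l - 1 - l) = - (l * p) + p * (expR l - 1) by ring.
by rewrite [leRHS]expRD ler_wpM2l ?expR_ge0// expR_ge1Dx.
Qed.

(** The probabilistic method with finite sums. If every set violated some constraint [k], the sum of
    the exponentials would be at least 1 for every set, hence also on average. The multipliers
    [lam k] may be negative, which covers lower tails. *)
Lemma union_chernoff (T K : finType) (p : R) (P : pred K) (Q : K -> {set T})
    (lam tau : K -> R) : 0 <= p -> p <= 1 ->
  \sum_(k | P k) expR (p * #|Q k|%:R * (expR (lam k) - 1 - lam k) - tau k) < 1
    ->
  exists S : {set T}, forall k, P k ->
    lam k * \sum_(t in Q k) ((t \in S)%:R - p) < tau k.
Proof.
move=> p0 p1 sum1; apply: contrapT => none.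
(* The law of a random subset containing each point independently with probability [p]. *)
pose W (f : {ffun T -> bool}) : R := \prod_t (if f t then p else 1 - p).
have W0 f : 0 <= W f.
  by apply: prodr_ge0 => t _; case: ifP => _ //; rewrite subr_ge0.
have W1 : \sum_f W f = 1.
  rewrite /W -(bigA_distr_bigA (fun _ b => if b then p else 1 - p)) /=.
  by rewrite big1// => t _; rewrite big_bool /= addrC subrK.
pose Z k (f : {ffun T -> bool}) : R := \sum_(t in Q k) ((f t)%:R - p).
have bad f : 1 <= \sum_(k | P k) expR (lam k * Z k f - tau k).
  have [k Pk kf] : exists2 k, P k & tau k <= lam k * Z k f.
    apply: contrapT => nk; apply: none; exists [set t | f t] => k Pk.
    rewrite ltNge; apply/negP => tk; apply: nk; exists k => //.
    by rewrite (le_trans tk)// /Z; under eq_bigr do rewrite inE.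
  rewrite (bigD1 k)//= (@le_trans _ _ (expR (lam k * Z k f - tau k)))//.
    by rewrite -[leLHS]expR0 ler_expR subr_ge0.
  by rewrite lerDl sumr_ge0// => j _; rewrite expR_ge0.
have : 1 <= \sum_(k | P k) expR (p * #|Q k|%:R * (expR (lam k) - 1 - lam k) -
  tau k).
  rewrite -{1}W1.
  apply: (@le_trans _ _ (\sum_f \sum_(k | P k) W f * expR (lam k * Z k f - tau
    k))).
    by apply: ler_sum => f _; rewrite -mulr_sumr ler_peMr.
  rewrite exchange_big /=; apply: ler_sum => k _.
  under eq_bigr do rewrite expRD mulrA.
  rewrite -mulr_suml expRD ler_wpM2r ?expR_ge0//.
  pose F (t : T) (b : bool) : R := (if b then p else 1 - p) *
    (if t \in Q k then expR (lam k * (b%:R - p)) else 1).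
  rewrite [leLHS](_ : _ = \sum_(f : {ffun T -> bool}) \prod_t F t (f t));
    last first.
    apply: eq_bigr => f _; rewrite big_split; congr (_ * _).
    by rewrite -big_mkcond /= /Z mulr_sumr expR_sum.
  rewrite -bigA_distr_bigA /=.
  apply: (@le_trans _ _ (\prod_t if t \in Q k then expR (p * (expR (lam k) - 1
    - lam k)) else 1)).
    apply: ler_prod => t _; rewrite big_bool /F /=; case: ifP => _.
      by rewrite expR_mgf_le// addr_ge0// mulr_ge0 ?expR_ge0// subr_ge0.
    by rewrite !mulr1 addrC subrK ler01 lexx.
  by rewrite -big_mkcond /= prodr_const -expRM_natl [X in expR X <= _](_ : _ =
    p * #|Q k|%:R * (expR (lam k) - 1 - lam k))//; ring.
by rewrite leNgt sum1.
Qed.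

(** Squaring and inverting exp(-l/2) >= 1 - l/2 bounds exp l by a rational function. Negative [l] is
    allowed, for the lower tail. *)
Lemma expR_sub1D_le (l : R) : l <= 1 -> expR l - 1 - l <= 2 * l ^+ 2.
Proof.
move=> l1.
have h : 0 < 1 - l / 2 by lra.
have E : expR (- (l / 2)) >= 1 - l / 2 by rewrite expR_ge1Dx.
suff : expR l <= 1 + l + 2 * l ^+ 2 by lra.
rewrite -[l in expR l]opprK expRN invf_ple ?posrE ?expR_gt0//; last nra.
have -> : - l = - (l / 2) + - (l / 2) by field.
rewrite expRD (@le_trans _ _ ((1 - l / 2) * (1 - l / 2)))//; last first.
  by rewrite ler_pM// ltW.
rewrite -div1r ler_pdivrMr; last nra.
have -> : (1 - l / 2) * (1 - l / 2) * (1 + l + 2 * l ^+ 2) =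
  1 + l ^+ 2 * ((1 - l) * (5 / 2 - l)) / 2 by field.
rewrite lerDl divr_ge0// mulr_ge0 ?sqr_ge0// mulr_ge0; lra.
Qed.

(* The exponent must beat the entropy of the choice of two sets of size at most
   [m], about [2 * m * ln (N / m)]. *)
Lemma exponent_bound (N m sd w La : R) : 1 <= m -> m <= N -> 0 < w -> w <= m ->
  m <= sd * w -> 1 <= La -> sd ^+ 2 <= expR La -> 0 < sd ->
  exists2 x, 0 < x & forall l, l = x \/ l = - x ->
    sd ^+ 2 * w ^+ 2 / N * (expR l - 1 - l) - x * (20 * sd * La * w)
      <= - (5 * m + 2 * m * ln (N / m)).
Proof.
move=> m1 mN w0 wm mw La1 sdLa sd0.
have N0 : 0 < N by lra.
have m0 : 0 < m by lra.
set mu := _ / N; set t := 20 * _ * _ * _.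
have mu0 : 0 < mu by rewrite divr_gt0// mulr_gt0// exprn_gt0.
have t0 : 0 < t by rewrite !mulr_gt0//; lra.
have tm : 20 * La * m <= t.
  rewrite /t (_ : 20 * sd * La * w = 20 * La * (sd * w)); last by ring.
  by rewrite ler_wpM2l//; lra.
have lnN0 : 0 <= ln (N / m) by rewrite ln_ge0// ler_pdivlMr// mul1r.
(* Gaussian regime: [x = t / (4 * mu)] minimises 2 mu x^2 - x t, and the minimum is - 50 La^2 N. *)
have [tmu|tmu] := leP t (4 * mu).
  exists (t / (4 * mu)); first by rewrite divr_gt0// mulr_gt0.
  set x := t / _.
  have x0 : 0 < x by rewrite divr_gt0// mulr_gt0.
  have x1 : x <= 1 by rewrite ler_pdivrMr ?mul1r// mulr_gt0.
  move=> l lx; have l1 : l <= 1 by case: lx => ->; lra.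
  have l2 : l ^+ 2 = x ^+ 2 by case: lx => ->; rewrite ?sqrrN.
  apply: le_trans (lerB (ler_wpM2l (ltW mu0) (expR_sub1D_le l1)) (lexx _)) _.
  rewrite l2 [leLHS](_ : _ = - (50 * La ^+ 2 * N)); last first.
    rewrite /x /mu /t; field; rewrite !gt_eqF//.
  rewrite lerN2.
  have lnm : m * ln (N / m) <= N.
    have : ln (N / m) <= N / m by rewrite ltW// ln_sublinear// divr_gt0.
    by rewrite -(ler_pM2l m0) mulrCA divff ?gt_eqF// mulr1.
  have : 1 <= La ^+ 2 by rewrite expr_ge1//; lra.
  move=> La2; have : N <= La ^+ 2 * N by rewrite ler_peMl// ltW.
  lra.
(* Here the entropy is only of order [La * m], and [x = 1] already gives [- t / 2], at most
   [- 10 * La * m]. *)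
have [Nm|Nm] := leP (ln (N / m)) (2 * La).
  exists 1; first by [].
  move=> l lx; have l1 : l <= 1 by case: lx => ->; lra.
  have l2 : l ^+ 2 = 1 by case: lx => ->; rewrite ?sqrrN expr1n.
  apply: le_trans (lerB (ler_wpM2l (ltW mu0) (expR_sub1D_le l1)) (lexx _)) _.
  rewrite l2.
  have : m * ln (N / m) <= m * (2 * La) by rewrite ler_wpM2l// ltW.
  have : m <= La * m by rewrite ler_peMl// ltW.
  lra.
(* Poisson regime for small sets: exp x is the square root of [N / m], the largest growth for which
   [mu * expR x] stays below [t / 20], while [x * t] gains the logarithm in the entropy. *)
set x := ln (N / m) / 2.
exists x; first by rewrite /x; lra.
have x1 : 1 <= x by rewrite /x; lra.
have expx : expR x ^+ 2 = N / m.
  by rewrite -expRM_natl mulrC divfK// lnK// posrE divr_gt0.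
have key : mu * expR x <= t / 20.
  have sd0' := ltW sd0; have w0' := ltW w0; have m0' := ltW m0;
    have N0' := ltW N0.
  have sdm : sd ^+ 2 * m <= N.
    rewrite -ler_pdivlMr// (le_trans sdLa)// -[leRHS]lnK ?posrE ?divr_gt0//.
    by rewrite ler_expR; lra.
  have : sd * w * expR x <= N.
    rewrite -ler_sqr ?nnegrE ?mulr_ge0 ?expR_ge0//.
    rewrite exprMn expx (@le_trans _ _ ((sd * m) ^+ 2 * (N / m)))//.
      rewrite ler_wpM2r ?divr_ge0// ler_sqr ?nnegrE ?mulr_ge0//.
      by rewrite ler_pM2l.
    rewrite [leLHS](_ : _ = sd ^+ 2 * m * N); last by field; rewrite gt_eqF.
    by rewrite expr2 ler_wpM2r//.
  move=> swN; rewrite /mu /t.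
  rewrite [leLHS](_ : _ = sd * w / N * (sd * w * expR x)); last by field;
    rewrite gt_eqF.
  rewrite [leRHS](_ : _ = sd * w / N * (La * N)); last by field; rewrite gt_eqF.
  rewrite ler_wpM2l ?divr_ge0 ?mulr_ge0//.
  by rewrite (le_trans swN)// ler_peMl.
have fin : 5 * m + 2 * m * ln (N / m) <= x * t / 2.
  have -> : ln (N / m) = 2 * x by rewrite /x; field.
  have : x * (20 * La * m) <= x * t by rewrite ler_wpM2l//; lra.
  have : m <= x * m by rewrite ler_peMl// ltW.
  have : x * m <= La * (x * m) by rewrite ler_peMl// mulr_ge0 ?ltW//; lra.
  lra.
have xt : t <= x * t by rewrite ler_peMl// ltW.
move=> l [] ->.
  have : 0 <= mu * (1 + x) by rewrite mulr_ge0//; lra.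
  rewrite -addrA -opprD mulrBr; lra.
have : mu * (expR (- x) - 1 - - x) <= mu * x.
  rewrite ler_wpM2l ?(ltW mu0)// opprK.
  have : expR (- x) <= 1 by rewrite expR_le1; lra.
  lra.
have : mu * x <= x * t / 4 by rewrite mulrC -mulrA ler_wpM2l//; lra.
lra.
Qed.
End Random.

(** A single term of the expansion of (1 + x)^N. At x = k / N this is the usual bound (e N / k)^k on
    the binomial coefficient. *)
Lemma binomial_mul_le (R : realType) (N k : nat) (x : R) : (k <= N)%N -> 0 <= x
  ->
  'C(N, k)%:R * x ^+ k <= expR (x * N%:R).
Proof.
move=> kN x0; apply: (@le_trans _ _ ((x + 1) ^+ N)).
  have kN' : (k < N.+1)%N by [].
  rewrite exprD1n (bigD1 (Ordinal kN'))//= mulr_natl lerDl.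
  by apply: sumr_ge0 => i _; rewrite mulrn_wge0// exprn_ge0.
by rewrite expRM_natr lerXn2r ?nnegrE ?expR_ge0 ?addr_ge0// addrC expR_ge1Dx.
Qed.

(** The sets of size [k] have weight (k / N)^k exp(-2k) each, so together at most exp(-k) <= 2^(-k),
    and the sum over positive [k] is below 1. *)
Lemma sum_entropy_le1 (R : realType) (N : nat) :
  \sum_(U : {set 'I_N} | (0 < #|U|)%N)
    expR (- (2 * #|U|%:R + #|U|%:R * ln (N%:R / #|U|%:R))) <= 1 :> R.
Proof.
pose g (k : nat) : R := expR (- (2 * k%:R + k%:R * ln (N%:R / k%:R))).
have cU (U : {set 'I_N}) : (#|U| < N.+1)%N by rewrite ltnS -[leqRHS]card_ord
  max_card.
rewrite (partition_big (fun U => Ordinal (cU U)) xpredT)//=.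
apply: (@le_trans _ _ (\sum_(k < N.+1) (0 < k)%N%:R * 2^-1 ^+ k)).
  apply: ler_sum => k _.
  rewrite (eq_bigr (fun=> g k)); last by move=> U /andP[_ /eqP <-].
  rewrite (eq_bigl (fun U : {set 'I_N} => (0 < k)%N && (U \in [set A : {set
    'I_N} | #|A| == k]))); last first.
    by move=> U; rewrite inE -val_eqE /=; case: eqP => [->|]; rewrite ?andbF.
  case: (posnP k) => [->|k0]; first by rewrite big_pred0// mul0r.
  rewrite /= mul1r sumr_const card_draws card_ord -[g k *+ _]mulr_natl.
  have kR : 0 < k%:R :> R by rewrite ltr0n.
  have kN : (k <= N)%N by rewrite -ltnS.
  have NR : 0 < N%:R :> R by rewrite ltr0n (leq_trans k0).
  have gE : g k = (k%:R / N%:R) ^+ k * expR (- (k%:R + k%:R)).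
    rewrite /g -[X in _ = X ^+ _ * _]lnK ?posrE ?divr_gt0// -expRM_natl -expRD;
      congr expR.
    by rewrite -[N%:R / _]invf_div lnV ?posrE ?divr_gt0//; ring.
  rewrite gE mulrA; apply: le_trans (ler_wpM2r (expR_ge0 _) (binomial_mul_le kN
    _)) _.
    by rewrite divr_ge0.
  rewrite divfK ?gt_eqF// -expRD (_ : _ + _ = k%:R * -1); last by ring.
  rewrite expRM_natl lerXn2r ?nnegrE ?expR_ge0 ?invr_ge0//.
  by rewrite expRN lef_pV2 ?posrE ?expR_gt0// (le_trans _ (expR_ge1Dx _)).
rewrite big_ord_recl mul0r add0r.
suff -> : \sum_(i < N) (0 < lift ord0 i)%N%:R * 2^-1 ^+ lift ord0 i = 1 - 2^-1
  ^+ N :> R.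
  by rewrite gerBl exprn_ge0// invr_ge0.
elim: N {g cU} => [|N IH]; first by rewrite big_ord0 expr0 subrr.
rewrite big_ord_recr /= IH mul1r /bump /= add1n exprS; by field.
Qed.

(** A union bound over pairs of sets and both signs of the deviation. The two size conditions say
    that the larger set is at most [Num.sqrt d] times the geometric mean of the sizes, as
    [exponent_bound] requires. *)
Lemma exists_low_discrepancy (R : realType) (N : nat) (d La : R) :
  (0 < N)%N -> 1 <= d -> d <= N%:R -> 1 <= La -> d <= expR La ->
  exists S : {set 'I_N * 'I_N}, forall U V : {set 'I_N},
    #|U|%:R <= d * #|V|%:R -> #|V|%:R <= d * #|U|%:R ->
    `|\sum_(i in U) \sum_(j in V) (((i, j) \in S)%:R - d / N%:R)| <=
      20 * Num.sqrt d * La * Num.sqrt (#|U|%:R * #|V|%:R).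
Proof.
move=> N0 d1 dN La1 dLa.
have NR : 0 < N%:R :> R by rewrite ltr0n.
have d0 : 0 < d by lra.
pose sd := Num.sqrt d.
have sd0 : 0 < sd by rewrite sqrtr_gt0.
have sd2 : sd ^+ 2 = d by rewrite sqr_sqrtr// ltW.
pose K : finType := ({set 'I_N} * {set 'I_N} * bool)%type.
pose u (k : K) : R := #|k.1.1|%:R; pose v (k : K) : R := #|k.1.2|%:R.
pose P (k : K) := [&& (0 < #|k.1.1|)%N, (0 < #|k.1.2|)%N, u k <= d * v k & v k
  <= d * u k].
pose w k := Num.sqrt (u k * v k).
pose t k := 20 * sd * La * w k.
pose m k := Num.max (u k) (v k).
pose G k := 5 * m k + 2 * m k * ln (N%:R / m k).
have cN (A : {set 'I_N}) : #|A|%:R <= N%:R :> R by rewrite ler_nat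
  -[leqRHS]card_ord max_card.
have uv1 k : P k -> 1 <= u k /\ 1 <= v k by case/and4P => u0 v0 _ _;
  rewrite !ler1n.
have w2 k : P k -> w k ^+ 2 = u k * v k by move=> _;
  rewrite sqr_sqrtr// mulr_ge0.
have um k : u k <= m k by rewrite le_max lexx.
have vm k : v k <= m k by rewrite le_max lexx orbT.
have xP k : exists x, P k -> 0 < x /\ forall l, l = x \/ l = - x ->
    d * w k ^+ 2 / N%:R * (expR l - 1 - l) - x * t k <= - G k.
  have [Pk|] := boolP (P k); last by exists 0.
  have [u1 v1] := uv1 _ Pk; have [_ _ ud vd] := and4P Pk.
  have m0 : 0 <= m k by apply: le_trans (um k).
  have wm : w k <= m k.
    rewrite -[leRHS]ger0_norm// -sqrtr_sqr ler_wsqrtr// expr2 ler_pM//; lra.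
  have mw : m k <= sd * w k.
    rewrite -[leLHS]ger0_norm// -sqrtr_sqr /w /sd -sqrtrM ?(ltW d0)//
      ler_wsqrtr// /m.
    have := ler_wpM2r (le_trans ler01 u1) ud;
      have := ler_wpM2r (le_trans ler01 v1) vd.
    by rewrite maxEle; case: ifP => _; rewrite expr2; lra.
  have [] := @exponent_bound R N%:R (m k) sd (w k) La _ _ _ wm mw La1 _ sd0.
  - exact: le_trans (um k).
  - by rewrite ge_max !cN.
  - by rewrite sqrtr_gt0 mulr_gt0//; lra.
  - by rewrite sd2.
  - by move=> x x0 xl; exists x => _; split => // l /xl; rewrite sd2.
have [x xE] := choice xP.
(* The entropy at the smaller size is dominated by the entropy at [m k], because a ln(m / a) <= m -
   a. *)
have entropy k (a : R) : P k -> 1 <= a -> a <= m k -> m k <= N%:R ->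
   2 * a + a * ln (N%:R / a) <= 2 * m k + m k * ln (N%:R / m k).
  move=> Pk a1 am mN.
  have a0 : 0 < a by lra.
  have m0 : 0 < m k by lra.
  have -> : N%:R / a = N%:R / m k * (m k / a) by field; rewrite !gt_eqF.
  rewrite lnM ?posrE ?divr_gt0//.
  have : a * ln (m k / a) <= m k - a.
    have -> : m k - a = a * (m k / a - 1) by field; rewrite gt_eqF.
    rewrite ler_wpM2l ?(ltW a0)// -[X in ln X](subrKC 1) le_ln1Dx//.
    by rewrite ltrBrDl subrr divr_gt0.
  have : a * ln (N%:R / m k) <= m k * ln (N%:R / m k).
    by rewrite ler_wpM2r// ln_ge0// ler_pdivlMr// mul1r.
  lra.
pose g (A : {set 'I_N}) : R := expR (- (2 * #|A|%:R + #|A|%:R * ln (N%:R /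
  #|A|%:R))).
have [| | |S HS] := @union_chernoff R ('I_N * 'I_N)%type K (d / N%:R) P
    (fun k => finset.setX (k.1.1 : {set 'I_N}) (k.1.2 : {set 'I_N})) (fun k =>
      if k.2 then x k else - x k) (fun k => x k * t k).
- by rewrite divr_ge0// ltW.
- by rewrite ler_pdivrMr// mul1r.
(* The two entropies use [4 * m k] of the [5 * m k] in [G]. The remaining [m k], at least 1, leaves
   a factor 1/e, which beats the factor 2 from the signs. *)
- apply: (@le_lt_trans _ _ (\sum_(k : K | (0 < #|k.1.1|)%N && (0 < #|k.1.2|)%N)
      (g k.1.1 * g k.1.2) * expR (- 1))).
    rewrite [leLHS]big_mkcond [leRHS]big_mkcond; apply: ler_sum => k _.
    case Pk : (P k); last first.
      by case: ifP => // _; rewrite !mulr_ge0 ?expR_ge0.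
    have [-> -> _ _] := and4P Pk.
    have [u1 v1] := uv1 _ Pk; have [_ xk] := xE _ Pk.
    have mN : m k <= N%:R by rewrite ge_max !cN.
    have m1 : 1 <= m k by apply: le_trans (um k).
    have eu := entropy k _ Pk u1 (um k) mN;
      have ev := entropy k _ Pk v1 (vm k) mN.
    rewrite /= -!expRD ler_expR cardsX natrM.
    have := xk (if k.2 then x k else - x k); rewrite w2//.
    rewrite (_ : d * (u k * v k) / N%:R = d / N%:R * (u k * v k));
      last by rewrite mulrAC.
    move=> H; apply: le_trans (H _) _; first by case: k.2; [left|right].
    rewrite /G; move: eu ev; rewrite /u /v; lra.
  rewrite -mulr_suml.
  have sg : \sum_(A : {set 'I_N} | (0 < #|A|)%N) g A <= 1 by exact:
    sum_entropy_le1.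
  have sg0 : 0 <= \sum_(A : {set 'I_N} | (0 < #|A|)%N) g A.
    by apply: sumr_ge0 => A _; exact: expR_ge0.
  rewrite [X in X * _](_ : _ = (\sum_(A : {set 'I_N} | (0 < #|A|)%N) g A) *
      (\sum_(A : {set 'I_N} | (0 < #|A|)%N) g A) * 2); last first.
    transitivity (\sum_(A : {set 'I_N} * {set 'I_N} | (0 < #|A.1|)%N && (0 <
      #|A.2|)%N)
        \sum_(b : bool) g A.1 * g A.2).
      rewrite pair_big /=; apply: eq_bigl => k; by rewrite andbT.
    under eq_bigr do rewrite big_bool /= -mulr2n -mulr_natr.
    rewrite -mulr_suml; congr (_ * _); rewrite mulr_suml.
    under [RHS]eq_bigr do rewrite mulr_sumr.
    by rewrite pair_big.
  rewrite expRN -ltr_pdivlMr ?invr_gt0 ?expR_gt0// invrK mul1r.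
  apply: (@le_lt_trans _ _ (1 + 1)); last by rewrite expR_gt1Dx// oner_eq0.
  by rewrite -[leRHS]mulr1 mulrC ler_pM ?mulr_ge0 ?mulr_ile1.
exists S => U V UV VU.
have rhs0 : 0 <= 20 * Num.sqrt d * La * Num.sqrt (#|U|%:R * #|V|%:R).
  by rewrite mulr_ge0 ?sqrtr_ge0// !mulr_ge0 ?sqrtr_ge0//; lra.
have [U0|U0] := posnP #|U|.
  by rewrite (cards0_eq U0) finset.big_set0 normr0 -(cards0_eq U0).
have [V0|V0] := posnP #|V|.
  rewrite big1 ?normr0// => i _; by rewrite (cards0_eq V0) finset.big_set0.
have Pk b : P (U, V, b) by rewrite /P /u /v /= U0 V0 UV VU.
have E : \sum_(i in U) \sum_(j in V) (((i, j) \in S)%:R - d / N%:R) =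
    \sum_(t in finset.setX U V) ((t \in S)%:R - d / N%:R).
  rewrite (pair_big _ _ (fun i j => ((i, j) \in S)%:R - d / N%:R)) /=.
  by apply: eq_big => [[i j]|[i j] _] //=; rewrite finset.in_setX.
have [x1 _] := xE _ (Pk true); have [x2 _] := xE _ (Pk false).
have := HS _ (Pk true); have := HS _ (Pk false).
rewrite /= -E mulNr -mulrN !ltr_pM2l// => H1 H2.
rewrite ler_norml; apply/andP; split; last exact: ltW.
by rewrite lerNl ltW.
Qed.

Lemma opbound_le (R : rcfType) (I J : finType) (B : I -> J -> R) (c c' : R) :
  c <= c' -> opbound B c -> opbound B c'.
Proof.
move=> cc' HB x y; apply: le_trans (HB x y) _.
by rewrite ler_wpM2r// mulr_ge0 ?sqrtr_ge0.
Qed.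

(** * Sparse sets with bounded degrees *)

Lemma sum_const_set (R : nzRingType) (I : finType) (U : {set I}) (c : R) :
  \sum_(i in U) c = #|U|%:R * c.
Proof. by rewrite sumr_const mulr_natl. Qed.

(** Markov's inequality: at most half of the values can exceed twice the bound on the average. *)
Lemma many_light (R : realType) (I : finType) (f : I -> R) (d : R) :
  0 < d -> (forall i, 0 <= f i) -> \sum_i f i <= 2 * d * #|I|%:R ->
  (#|I| <= 2 * #|[set i | (f i <= 4 * d)%R]|)%N.
Proof.
move=> d0 f0 fd; set A := [set i | _].
have : 4 * d * #|~: A|%:R <= 2 * d * #|I|%:R.
  apply: le_trans fd; rewrite -sum1_card natr_sum mulr_sumr big_mkcond /=.
  by apply: ler_sum => i _; rewrite !inE; case: (leP (f i)) => /= [_|/ltW];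
    rewrite ?mulr1 ?f0.
have -> : 4 * d * #|~: A|%:R = 2 * d * (2 * #|~: A|)%:R by rewrite natrM; ring.
rewrite ler_pM2l ?mulr_gt0// ler_nat.
by have := cardsC A; lia.
Qed.

Lemma exists_injection_into (T : finType) (G : {set T}) n : (n <= #|G|)%N ->
  exists2 f : 'I_n -> T, injective f & forall i, f i \in G.
Proof.
move=> nG; exists (fun i => enum_val (widen_ord nG i)).
  by move=> i j /enum_val_inj /(congr1 val) /= ij; exact: val_inj.
by move=> i; exact: enum_valP.
Qed.

Lemma sum_comp_inj_le (R : realType) (I J : finType) (h : I -> J) (F : J -> R) :
  injective h -> (forall j, 0 <= F j) -> \sum_i F (h i) <= \sum_j F j.
Proof.
move=> hI F0; rewrite (eq_bigl (fun i => i \in [set: I])); last by move=> i;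
  rewrite inE.
rewrite -(@big_imset _ _ _ _ _ h); last by move=> ? ? _ _; exact: hI.
by rewrite big_mkcond; apply: ler_sum => j _; case: ifP.
Qed.

(** A crude bound for pairs of sets whose sizes differ by more than the factor [d], which the random
    construction does not cover. *)
Lemma discrepancy_le_degree (R : realType) (I J : finType) (s : I -> J -> R)
    (p k c : R) (U : {set I}) (V : {set J}) :
  (forall i j, 0 <= s i j) -> 0 <= p -> (forall i, \sum_j s i j <= k) ->
  p * #|V|%:R <= c ->
  `|\sum_(i in U) \sum_(j in V) (s i j - p)| <= #|U|%:R * (k + c).
Proof.
move=> s0 p0 sk pc; apply: le_trans (ler_norm_sum _ _ _) _.
apply: (@le_trans _ _ (\sum_(i in U) (k + c)));
  last by rewrite sumr_const mulr_natl.
apply: ler_sum => i _; rewrite sumrB sum_const_set [_ * p]mulrC.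
apply: le_trans (ler_normB _ _) _; apply: lerD; last first.
  by rewrite ger0_norm// mulr_ge0.
rewrite ger0_norm ?sumr_ge0//; apply: le_trans (sk i).
by rewrite big_mkcond; apply: ler_sum => j _; case: ifP.
Qed.

(* Passing from a random subset of a grid of twice the size to the [n] rows and
   columns of small degree bounds all the degrees by a multiple of [d], which
   fails for a random subset of the original grid when [d] is constant. *)
Lemma exists_sparse_discrepancy (R : realType) (n : nat) (d La : R) :
  (0 < n)%N -> d <= n%:R -> 1 <= La -> d <= expR La -> 80 * La <= Num.sqrt d ->
  exists S : {set 'I_n * 'I_n},
  [/\ forall U V : {set 'I_n},
        `|\sum_(i in U) \sum_(j in V) (((i, j) \in S)%:R - d / (2 * n%:R))| <=
          20 * Num.sqrt d * La * Num.sqrt (#|U|%:R * #|V|%:R),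
      forall i, \sum_j ((i, j) \in S)%:R <= 4 * d
    & forall j, \sum_i ((i, j) \in S)%:R <= 4 * d].
Proof.
move=> n0 dn La1 dLa sdLa.
have nR : 0 < n%:R :> R by rewrite ltr0n.
set sd := Num.sqrt d in sdLa *.
have sd1 : 80 <= sd by lra.
have d0 : 0 < d by rewrite -sqrtr_gt0 -/sd; lra.
have sd2 : d = sd * sd by rewrite -expr2 sqr_sqrtr// ltW.
have d1 : 6400 <= d by rewrite sd2 (_ : 6400 = 80 * 80) ?ler_pM//; ring.
have d_La : 80 * La * sd <= d by rewrite [leRHS]sd2 ler_pM2r//; lra.
have [] := @exists_low_discrepancy R (2 * n) d La _ _ _ La1 dLa.
- by rewrite muln_gt0.
- lra.
- by rewrite natrM; lra.
rewrite natrM; set p := d / _ => S HS.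
have p0 : 0 <= p by rewrite divr_ge0 ?mulr_ge0 ?ltW.
pose b i j : R := ((i, j) \in S)%:R.
have cT : #|[set: 'I_(2 * n)]|%:R = 2 * n%:R :> R by rewrite cardsT card_ord
  natrM.
have n2 : 0 < 2 * n%:R :> R by rewrite mulr_gt0.
(* The expected total is [d * (2 * n%:R)], and the discrepancy of the whole grid is at most a
   quarter of it because [80 * La <= sd]. *)
have tot : \sum_i \sum_j b i j <= 2 * d * (2 * n%:R).
  have := HS [set: _] [set: _]; rewrite cT -expr2 sqrtr_sqr (gtr0_norm n2).
  have h : 2 * n%:R <= d * (2 * n%:R) by rewrite ler_peMl// ?mulr_ge0//; lra.
  move=> /(_ h h); rewrite ler_norml => /andP[_].
  rewrite (_ : \sum_(i in [set: _]) _ = \sum_i \sum_j b i j - d * (2 * n%:R)).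
    rewrite -/sd => H.
    have : 80 * La * sd * (2 * n%:R) <= d * (2 * n%:R) by rewrite ler_wpM2r//
      mulr_ge0.
    have : 0 <= d * (2 * n%:R) by rewrite !mulr_ge0// ltW.
    lra.
  under eq_bigr do rewrite sumrB sum_const_set.
  rewrite sumrB sum_const_set cT; congr (_ - _); last by rewrite /p; field;
    rewrite gt_eqF.
  apply: eq_big => [i|i _]; first by rewrite inE.
  by apply: eq_bigl => j; rewrite inE.
have c2 : #|'I_(2 * n)|%:R = 2 * n%:R :> R by rewrite card_ord natrM.
have b0 i j : 0 <= b i j by [].
have [f fI fG] : exists2 f : 'I_n -> 'I_(2 * n), injective f &
    forall i, f i \in [set i | \sum_j b i j <= 4 * d].
  apply: exists_injection_into; have := @many_light R _ (fun i => \sum_j b i j)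
    d d0.
  rewrite c2 card_ord => /(_ _ tot) H;
    rewrite -(leq_pmul2l (isT : 0 < 2)%N) H// => i.
  by apply: sumr_ge0 => j _; exact: b0.
have [h hI hG] : exists2 h : 'I_n -> 'I_(2 * n), injective h &
    forall j, h j \in [set j | \sum_i b i j <= 4 * d].
  apply: exists_injection_into; have := @many_light R _ (fun j => \sum_i b i j)
    d d0.
  rewrite c2 card_ord exchange_big => /(_ _ tot) H.
  rewrite -(leq_pmul2l (isT : 0 < 2)%N) H// => i.
  by apply: sumr_ge0 => j _; exact: b0.
exists [set t | (f t.1, h t.2) \in S].
have row i : \sum_j ((i, j) \in [set t | (f t.1, h t.2) \in S])%:R <= 4 * d.
  have := fG i; rewrite inE; apply: le_trans.
  under eq_bigr do rewrite inE /=.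
  exact: (sum_comp_inj_le hI (b0 (f i))).
have col j : \sum_i ((i, j) \in [set t | (f t.1, h t.2) \in S])%:R <= 4 * d.
  have := hG j; rewrite inE; apply: le_trans.
  under eq_bigr do rewrite inE /=.
  exact: (sum_comp_inj_le fI (fun i => b0 i (h j))).
split=> // U V.
have cn (A : {set 'I_n}) : #|A|%:R <= n%:R :> R by rewrite ler_nat
  -[leqRHS]card_ord max_card.
have pn (A : {set 'I_n}) : p * #|A|%:R <= d.
  apply: le_trans (ler_wpM2l p0 (cn A)) _.
  by rewrite /p (_ : d / _ * _ = d / 2); [lra|field; rewrite gt_eqF].
(* For unbalanced sizes the geometric mean is at least [sd * a], so the target exceeds the degree
   bound [5 * d * a]. *)
have sqrt_le (a c : R) : 0 <= a -> d * a < c -> a * (4 * d + d) <= 20 * sd * La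
  * Num.sqrt (c * a).
  move=> a0 ac; apply: (@le_trans _ _ (20 * sd * La * (sd * a))).
    rewrite (_ : a * _ = 5 * (d * a)); last by ring.
    rewrite (_ : 20 * _ * _ * _ = 20 * (La * (d * a))); last by rewrite sd2;
      ring.
    have : d * a <= La * (d * a) by rewrite ler_peMl// mulr_ge0// ltW.
    have : 0 <= d * a by rewrite mulr_ge0// ltW.
    lra.
  have sd_ge0 : 0 <= sd by exact: sqrtr_ge0.
  rewrite ler_wpM2l ?mulr_ge0 ?(le_trans ler01 La1)//.
  rewrite -[leLHS]ger0_norm ?mulr_ge0//.
  rewrite -sqrtr_sqr ler_wsqrtr// exprMn expr2 -sd2 expr2 mulrA.
  by rewrite ler_wpM2r// ltW.
have [UV|/sqrt_le UV] := leP #|U|%:R (d * #|V|%:R); last first.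
  apply: le_trans (UV _) => //; rewrite exchange_big.
  exact: (discrepancy_le_degree _ (fun j i => _) p0 col (pn U)).
have [VU|/sqrt_le VU] := leP #|V|%:R (d * #|U|%:R); last first.
  rewrite (mulrC #|U|%:R); apply: le_trans (VU _) => //.
  exact: (discrepancy_le_degree _ (fun i j => _) p0 row (pn V)).
have := HS (f @: U) (h @: V); rewrite !card_imset// => /(_ UV VU).
rewrite big_imset /=; last by move=> ? ? _ _; exact: fI.
under eq_bigr => i _.
  rewrite big_imset /=; last by move=> ? ? _ _; exact: hI.
  over.
by under [X in _ -> `|X| <= _]eq_bigr do under eq_bigr do rewrite inE.
Qed.

Lemma mixing_constant (R : realType) (sd La g x : R) :
  1 <= sd -> 1 <= La -> g <= 7 * La -> x <= 10 ->
  20 * (2 * (20 * sd * La)) * g + x <= 5610 * sd * La ^+ 2.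
Proof.
move=> sd1 La1 gLa x10.
have sL : 1 <= sd * La by rewrite -[leLHS]mulr1 ler_pM.
have : 1 <= sd * La * La by rewrite -[leLHS]mulr1 ler_pM.
have : sd * La * g <= sd * La * (7 * La) by rewrite ler_wpM2l// (le_trans
  ler01).
lra.
Qed.

(** The discrepancy of the full grid puts |S| near [d * n / 2] and the true density [q] within
    [al / n] of the nominal [p]. Centring at [q] therefore only doubles the discrepancy constant,
    and [inverse_mixing] applies. *)
Lemma exists_sampling_set (R : realType) (n : nat) (d La : R) :
  (0 < n)%N -> d <= n%:R -> 1 <= La -> d <= expR La -> 80 * La <= Num.sqrt d ->
  exists S : {set 'I_n * 'I_n},
  [/\ d * n%:R / 4 <= #|S|%:R, #|S|%:R <= d * n%:R
    & opbound (fun i j => ((i, j) \in S)%:R - #|S|%:R / n%:R ^+ 2)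
        (5610 * Num.sqrt d * La ^+ 2)].
Proof.
move=> n0 dn La1 dLa sdLa.
have [S [disc row col]] := exists_sparse_discrepancy n0 dn La1 dLa sdLa.
exists S.
have nR : 0 < n%:R :> R by rewrite ltr0n.
set sd := Num.sqrt d in sdLa disc *.
have sd1 : 80 <= sd by lra.
have d0 : 0 < d by rewrite -sqrtr_gt0 -/sd; lra.
have sd2 : d = sd * sd by rewrite -expr2 sqr_sqrtr// ltW.
have d_La : 80 * La * sd <= d by rewrite [leRHS]sd2 ler_pM2r//; lra.
set p := d / _ in disc *; set q := #|S|%:R / _.
pose al := 20 * sd * La.
have al0 : 0 <= al by rewrite !mulr_ge0//; lra.
have cn (A : {set 'I_n}) : #|A|%:R <= n%:R :> R by rewrite ler_nat
  -[leqRHS]card_ord max_card.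
have cS : \sum_(i in [set: 'I_n]) \sum_(j in [set: 'I_n]) ((i, j) \in S)%:R =
  #|S|%:R :> R.
  rewrite pair_big /= -sum1_card natr_sum [RHS]big_mkcond.
  by apply: eq_big => [t|[i j] _]; rewrite ?inE//=; case: ifP.
have near : `|#|S|%:R - d * n%:R / 2| <= al * n%:R.
  have := disc [set: _] [set: _].
  rewrite cardsT card_ord -expr2 sqrtr_sqr (gtr0_norm nR) -/al.
  congr (`|_| <= _); under eq_bigr do rewrite sumrB.
  rewrite sumrB cS; congr (_ - _).
  under eq_bigr do rewrite sum_const_set.
  rewrite sum_const_set cardsT card_ord /p; field; by rewrite gt_eqF.
have aln : al * n%:R <= d * n%:R / 4.
  rewrite [leRHS]mulrAC ler_wpM2r ?(ltW nR)// /al; lra.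
have /andP[S1 S2] : d * n%:R / 4 <= #|S|%:R <= d * n%:R * (3 / 4).
  by move: near; rewrite ler_norml => /andP[? ?]; apply/andP; split; lra.
have dn0 : 0 <= d * n%:R by rewrite mulr_ge0// ltW.
split=> //; first lra.
have q0 : 0 <= q by rewrite divr_ge0// exprn_ge0.
have qn : q * n%:R <= d.
  by rewrite /q expr2 invfM mulrA divfK ?gt_eqF// ler_pdivrMr//; lra.
have pq : `|p - q| <= al / n%:R.
  rewrite (_ : p - q = - (#|S|%:R - d * n%:R / 2) / n%:R ^+ 2);
    last by rewrite /p /q; field; rewrite gt_eqF.
  rewrite normrM normrN normfV (ger0_norm (exprn_ge0 _ (ltW nR))).
  rewrite ler_pdivrMr ?exprn_gt0// (le_trans near)//.
  by rewrite expr2 mulrA divfK ?gt_eqF.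
(* The gap is just large enough for [d <= 2 ^+ g], through exp(1/2) <= 2. The far levels then
   contribute at most 10, and the near ones a factor [2 * g + 1] of order [La]. *)
pose g := (Num.truncn (2 * La)).+1.
have La20 : 0 <= 2 * La by lra.
have g1 : 2 * La < g%:R by rewrite -truncn_lt_nat.
have g2 : g%:R <= 3 * La.
  rewrite /g; case E : (Num.truncn _) => [|k]; first lra.
  by have := truncn_gt_nat (2 * La) k; rewrite E ltnSn => /esym;
    rewrite -[k.+2]addn1 natrD; lra.
have dg : d <= 2 ^+ g.
  have e2 : expR (1 / 2) <= 2 :> R.
    rewrite -ler_sqr ?nnegrE ?expR_ge0// -expRM_natl (_ : _ * _ = 1);
      last by field.
    by have := expR_sub1D_le (lexx (1 : R)); rewrite expr1n; lra.
  apply: le_trans dLa _; apply: (@le_trans _ _ (expR (g%:R * (1 / 2)))).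
    by rewrite ler_expR; lra.
  by rewrite expRM_natl lerXn2r ?nnegrE ?expR_ge0.
apply: opbound_le (@inverse_mixing R _ _ _ n%:R (2 * al) (5 * d) g nR _ _ _ _ _
  _ _).
- apply: mixing_constant => //; first lra.
    by rewrite natrD natrM; lra.
  rewrite ler_pdivrMr ?exprn_gt0// (_ : 2 * (5 * d) = 10 * d); last by ring.
  by rewrite ler_pM2l.
- by rewrite mulr_ge0.
- by rewrite mulr_ge0// ltW.
- by rewrite card_ord.
- by rewrite card_ord.
- move=> U V; set c := Num.sqrt _.
  have c2 : c * c = #|U|%:R * #|V|%:R by rewrite -expr2 sqr_sqrtr// mulr_ge0.
  have cnn : c <= n%:R.
    rewrite -[leRHS]ger0_norm// -sqrtr_sqr ler_wsqrtr// expr2 ler_pM//.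
  have -> : \sum_(i in U) \sum_(j in V) (((i, j) \in S)%:R - q) =
      \sum_(i in U) \sum_(j in V) (((i, j) \in S)%:R - p) + (p - q) * (c * c).
    rewrite c2 mulrCA [X in _ + X](_ : _ = \sum_(i in U) \sum_(j in V) (p -
      q)); last first.
      by under eq_bigr do rewrite sum_const_set; rewrite sum_const_set; ring.
    rewrite -big_split; apply: eq_bigr => i _; rewrite -big_split;
      apply: eq_bigr => j _ /=.
    by rewrite addrA subrK.
  rewrite (_ : 2 * al * c = al * c + al * c); last by ring.
  apply: le_trans (ler_normD _ _) (lerD (disc _ _) _).
  rewrite normrM (ger0_norm (_ : 0 <= c * c)); last by rewrite c2 mulr_ge0.
  apply: (@le_trans _ _ (al / n%:R * (n%:R * c))).
    by rewrite ler_pM// ?c2 ?mulr_ge0// -c2 ler_wpM2r// sqrtr_ge0.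
  by rewrite mulrA divfK ?gt_eqF.
- move=> i; apply: le_trans (_ : \sum_j (((i, j) \in S)%:R + q) <= _).
    by apply: ler_sum => j _; rewrite (le_trans (ler_normB _ _))// !ger0_norm.
  rewrite big_split sumr_const card_ord -[q *+ n]mulr_natr /=.
  by have := row i; lra.
- move=> j; apply: le_trans (_ : \sum_i (((i, j) \in S)%:R + q) <= _).
    by apply: ler_sum => i _; rewrite (le_trans (ler_normB _ _))// !ger0_norm.
  rewrite big_split sumr_const card_ord -[q *+ n]mulr_natr /=.
  by have := col j; lra.
Qed.

(** * Sampling *)

(** Testing the form at [x = M z] gives |M z|^2 <= c |M z| |z|. *)
Lemma spectral_norm_le (R : realType) n (M : 'M[R]_n) c : 0 <= c ->
  (forall x y : 'I_n -> R, sqsum x <= 1 -> sqsum y <= 1 ->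
    \sum_i \sum_j M i j * x i * y j <= c) -> spectral_norm M <= c.
Proof.
move=> c0 /opbound_unit Mc; apply: ge_sup.
  exists (l2norm (M *m (0 : 'cV_n))), 0 => //=.
  by rewrite /l2norm big1 ?sqrtr0// => i _; rewrite mxE expr0n.
move=> _ [z /= z1 <-]; set w := l2norm _.
have w0 : 0 <= w by exact: sqrtr_ge0.
have : w * w <= c * (w * l2norm z).
  apply: le_trans (Mc (fun i => (M *m z) i 0) (fun j => z j 0)).
  rewrite -expr2 sqr_sqrtr ?sumr_ge0// => [|i _]; last exact: sqr_ge0.
  apply: ler_sum => i _; rewrite expr2 {2}mxE mulr_sumr.
  by apply: ler_sum => j _; rewrite mulrCA mulrA.
have [->//|wn0] := eqVneq w 0.
rewrite mulrCA ler_pM2l ?lt_def ?wn0//.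
by move=> /le_trans; apply; rewrite ler_piMr.
Qed.

(** The density constant is exp k, and its logarithm enters [La] as [8 + k], so the square root of
    exp k must beat [M * (8 + k) ^+ 2]. The cubic term of the exponential suffices. *)
Lemma exists_constant (R : realType) (M : R) : 1 <= M ->
  exists2 k : R, 0 < k & M * (8 + k) ^+ 2 <= expR (k / 2).
Proof.
move=> M1; exists (192 * M); first lra.
have k0 : 0 <= 192 * M / 2 by lra.
apply: le_trans (expR_ge1Dxn 2 k0).
have : M * (8 + 192 * M) ^+ 2 <= M * (384 * M) ^+ 2.
  apply: ler_wpM2l; first lra.
  by apply: lerXn2r; rewrite ?nnegrE; lra.
have -> : M * (384 * M) ^+ 2 = (192 * M / 2) ^+ 3 / (3`!)%:R.
  by rewrite (_ : 3`! = 6%N)//; field.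
lra.
Qed.

Lemma sampling_constant (R : realType) (eps sd La q : R) : 0 <= sd ->
  5610 * 512 * 4 * La ^+ 2 <= eps ^+ 2 * sd -> sd ^+ 2 / 4 <= q ->
  5610 * sd * La ^+ 2 <= eps ^+ 2 * q / 512.
Proof.
move=> sd0 /(ler_wpM2l sd0) sdLa /(ler_wpM2l (sqr_ge0 eps)) qsd.
lra.
Qed.

(* The logarithmic factor is read as max(1, ln(1/eps)), which is ln(1/eps)
   itself for eps <= 1/e.  With the bare logarithm the bound would drop below 1
   as eps tends to 1, forcing S to be empty, and the inequality would then fail
   for the all-ones matrix. *)
Theorem theorem4 (R : realType) :
  exists C : R, 0 < C /\
  forall (n : nat) (eps : R), (0 < n)%N -> 0 < eps -> eps < 1 ->
  exists S : {set 'I_n * 'I_n},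
    #|S|%:R <= C * (n%:R * Num.max 1 (ln (1 / eps)) ^+ 4 / eps ^+ 4) /\
    forall A : 'M[R]_n, A^T = A -> bounded_entries A ->
      spectral_norm (A - hadamard A (sampling_matrix R S))
        <= eps * Num.max n%:R (nuclear_norm A).
Proof.
(* The factors come from the operator bound of [exists_sampling_set], the hypothesis of
   [sampling_error], and |S| >= d n / 4. *)
pose M : R := 5610 * 512 * 4.
have [|k k0 kM] := @exists_constant R M; first by rewrite /M; lra.
exists (expR k); split=> [|n eps n0 e0 e1]; first exact: expR_gt0.
have nR : 0 < n%:R :> R by rewrite ltr0n.
set L := Num.max 1 _.
have L1 : 1 <= L by rewrite le_max lexx.
have Le : ln (1 / eps) <= L by rewrite le_max lexx orbT.
have L0 : 0 < L by lra.
pose sd := expR (k / 2) * L ^+ 2 / eps ^+ 2.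
have sd0 : 0 < sd by rewrite divr_gt0 ?mulr_gt0 ?expR_gt0 ?exprn_gt0.
pose d := sd ^+ 2.
have sdE : Num.sqrt d = sd by rewrite sqrtr_sqr gtr0_norm.
have dE : d = expR k * (L ^+ 4 / eps ^+ 4).
  rewrite {1}(_ : k = 2 * (k / 2)); last by field.
  by rewrite expRM_natl /d /sd; field; rewrite gt_eqF.
have -> : expR k * (n%:R * L ^+ 4 / eps ^+ 4) = d * n%:R by rewrite dE; ring.
have mx0 (A : 'M[R]_n) : 0 <= eps * Num.max n%:R (nuclear_norm A).
  by rewrite mulr_ge0 ?(ltW e0)// le_max ler0n.
(* If [d] exceeds [n], the budget allows all entries, and sampling them all makes no error. *)
have [dn|nd] := leP d n%:R; last first.
  exists [set: _]; rewrite cardsT card_prod card_ord natrM; split.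
    by rewrite ler_wpM2r// ltW.
  move=> A _ _; apply: spectral_norm_le => // x y _ _.
  rewrite big1 ?mx0// => i _; rewrite big1// => j _.
  rewrite !mxE inE cardsT card_prod card_ord natrM -expr2 divff ?expf_neq0
    ?gt_eqF//.
  by rewrite mulr1 subrr !mul0r.
(* In [d], the factors [L ^+ 4] and [eps ^- 4] are each at most exp(4 L), which accounts for the
   8. *)
pose La := (8 + k) * L.
have La1 : 1 <= La by rewrite -[leLHS]mulr1 ler_pM//; lra.
have dLa : d <= expR La.
  have LeL : L <= expR L by rewrite (le_trans _ (expR_ge1Dx L))// lerDr.
  have eL : eps^-1 <= expR L.
    by rewrite -div1r -[leLHS]lnK ?posrE ?divr_gt0// ler_expR.
  apply: (@le_trans _ _ (expR k * (expR L ^+ 4 * expR L ^+ 4))).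
    rewrite dE ler_wpM2l ?expR_ge0// -exprVn.
    by rewrite ler_pM ?exprn_ge0 ?invr_ge0 ?(ltW e0) ?(ltW L0)// lerXn2r
      ?nnegrE ?expR_ge0 ?invr_ge0 ?(ltW e0) ?(ltW L0).
  rewrite -!expRM_natl -!expRD ler_expR /La.
  have : k <= k * L by rewrite ler_peMr// ltW.
  lra.
have MLa : M * La ^+ 2 <= eps ^+ 2 * sd.
  have -> : eps ^+ 2 * sd = expR (k / 2) * L ^+ 2 by rewrite /sd; field;
    rewrite gt_eqF.
  by rewrite /La exprMn mulrA; apply: ler_wpM2r => //; apply: exprn_ge0;
    exact: ltW.
have sdLa : 80 * La <= sd.
  have : eps ^+ 2 * sd <= sd by rewrite ger_pMl// expr_le1// ltW.
  have : La <= La ^+ 2 by rewrite expr2 ler_peMl//; lra.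
  by rewrite /M in MLa; lra.
have [|S [S1 S2 HB]] := @exists_sampling_set R n d La n0 dn La1 dLa;
  first by rewrite sdE.
rewrite sdE in HB.
exists S; split=> // A _ A1.
set q := #|S|%:R / _ in HB.
have SR : 0 < #|S|%:R :> R.
  by apply: lt_le_trans S1; rewrite divr_gt0// mulr_gt0// exprn_gt0.
have q0 : 0 < q by rewrite divr_gt0// exprn_gt0.
apply: spectral_norm_le => // x y x1 y1.
(* The nonzero sampling weights are [1 / q], so multiplying by [q] leaves minus the entrywise
   product of [A] with the centred indicator; the sign is moved to [x]. *)
rewrite -(ler_pM2l q0) mulrA.
rewrite (_ : q * _ = \sum_i \sum_j A i j * (((i, j) \in S)%:R - q) * (- x i) *
  y j); last first.
  rewrite mulr_sumr; apply: eq_bigr => i _; rewrite mulr_sumr;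
    apply: eq_bigr => j _.
  rewrite !mxE /q; case: ifP => _; rewrite /=; field; rewrite !gt_eqF//.
apply: (@sampling_error R n A (fun i j => ((i, j) \in S)%:R - q) q _ eps (fun i
  => - x i) y n0 e0 e1 (ltW q0) A1 _ _ HB).
- move=> i j; apply: le_trans (ler_normB _ _) _.
  by rewrite (ger0_norm (ler0n _ _)) (ger0_norm (ltW q0)); lra.
- by apply: mulr_ge0; [apply: mulr_ge0;
    [exact: ler0n|exact: ltW]|exact: sqr_ge0].
- apply: sampling_constant MLa _ => //; first exact: ltW.
  rewrite -/d /q expr2 invfM mulrA divfK ?gt_eqF//.
  by rewrite ler_pdivlMr// mulrAC.
- by rewrite /sqsum; under eq_bigr do rewrite sqrrN.
- by [].
Qed.
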